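(* There are only finitely many conjugacy classes (under conjugation in $\mathrm{PSL}(2,\mathbb{C})$) of nearly arithmetic regular triangle Kleinian groups.
   Context: $\mathrm{PSL}(2,\mathbb{C})$ is identified with the group of orientation-preserving isometries of hyperbolic 3-space $\mathbb{H}^3$. A Kleinian group is a discrete subgroup of $\mathrm{PSL}(2,\mathbb{C})$ that is nonelementary, i.e. has no abelian subgroup of finite index. A half-turn in a hyperbolic line is the rotation by angle $\pi$ about that line (its axis). Complex distance: for two oriented hyperbolic lines, the complex distance is $\mu=x+iy$, $x\ge 0$, $y\in[0,2\pi)$, where $x$ is the length of their common perpendicular and $y$ is the angle between the lines, taken from the first to the second respecting orientations. A half-turn in an oriented line $m$ corresponds to a matrix $M\in\mathrm{SL}(2,\mathbb{C})$ with $\mathrm{tr}(M)=0$ (the two matrices $\pm M$ corresponding to the two orientations), and $\cosh\mu(m_1,m_2)=-\frac12\mathrm{tr}(M_1M_2)$. Regular triangle group: a group $\Gamma=\langle a,b,c\rangle\subset\mathrm{PSL}(2,\mathbb{C})$ generated by three half-turns $a,b,c$ whose axes can be oriented so that the three complex distances $\mu(a,b)$, $\mu(a,c)$, $\mu(c,b)$ between the oriented axes are all equal. Arithmetic: a subgroup $\Gamma$ of $\mathrm{PSL}(2,\mathbb{C})$ is arithmetic if there exist (i) a quaternion algebra $A$ over a number field $k\subset\mathbb{C}$ having exactly one complex place (one pair of complex conjugate embeddings, the inclusion $k\subset\mathbb{C}$ being one of them), such that $A\otimes_\phi\mathbb{R}$ is isomorphic to the Hamilton quaternions for every real place $\phi:k\to\mathbb{R}$,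 where $A$ is regarded as a $k$-subalgebra of $A\otimes_k\mathbb{C}\cong M(2,\mathbb{C})$; and (ii) an order $O$ of $A$ such that $\Gamma$ is commensurable with $p(O^1)$, where $O^1$ is the group of elements of $O$ of reduced norm $1$ and $p:\mathrm{SL}(2,\mathbb{C})\to\mathrm{PSL}(2,\mathbb{C})$ is the canonical projection; commensurable means that some finite index subgroup of $\Gamma$ is a finite index subgroup of $p(O^1)$. Nearly arithmetic: a subgroup $\Gamma$ of $\mathrm{PSL}(2,\mathbb{C})$ is nearly arithmetic if it is a subgroup of an arithmetic Kleinian group and is not isomorphic to a free product of cyclic groups. *)

(* Defs.v *)
From HB Require Import structures.
From mathcomp Require Import all_boot all_order all_algebra all_field.
From mathcomp Require Import generic_quotient ring.
From mathcomp Require Import complex.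
From mathcomp Require Import all_classical all_reals all_analysis.

Set Implicit Arguments.
Unset Strict Implicit.
Unset Printing Implicit Defensive.

Import Order.TTheory GRing.Theory Num.Theory.
Import numFieldNormedType.Exports.

Local Open Scope classical_set_scope.
Local Open Scope ring_scope.

Section Subgroups.
Variable G : groupType.
Implicit Types (S H K : set G).
Local Open Scope group_scope.

Definition is_subgroup H : Prop :=
  [/\ H 1, (forall x y, H x -> H y -> H (x * y)) & (forall x, H x -> H x^-1)].

Definition generated S : set G := smallest is_subgroup S.

Definition abelian_set H : Prop := forall x y, H x -> H y -> x * y = y * x.

Definition finite_index_subgroup H K : Prop :=
  [/\ is_subgroup H, H `<=` K &
      exists s : seq G, forall x, K x -> exists2 r, r \in s & H (r^-1 * x)].

Definition commensurable H K : Prop :=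
  exists D, finite_index_subgroup D H /\ finite_index_subgroup D K.

Definition conjugacy_class H : set (set G) :=
  [set [set x ^ g | x in H] | g in setT].

Definition cyclic_subgroup H : Prop := exists x, H = generated [set x].

(* A reduced word: no letter is trivial and consecutive letters come from
   factors with different indices. *)
Fixpoint reduced_word (I : Type) (H : I -> set G) (w : seq (I * G)) : Prop :=
  match w with
  | [::] => True
  | (i, x) :: w' =>
      [/\ H i x, x <> 1, reduced_word H w' &
          match w' with [::] => True | (j, _) :: _ => i <> j end]
  end.

(* K is the (internal) free product of the family of subgroups H: the family
   generates K and no nonempty reduced word represents 1. *)
Definition internal_free_product (I : Type) (H : I -> set G) K : Prop :=
  [/\ (forall i, is_subgroup (H i)),
      K = generated (\bigcup_i H i) &
      forall w, reduced_word H w -> w <> [::] ->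
        \prod_(u <- w) u.2 <> 1].

Definition free_product_of_cyclics K : Prop :=
  exists (I : Type) (H : I -> set G),
    (forall i, cyclic_subgroup (H i)) /\ internal_free_product H K.

End Subgroups.

(* The quaternion algebra (a, b / F): basis 1, i, j, ij with i^2 = a, j^2 = b,
   ji = - ij.  In characteristic different from 2 and for nonzero a, b these
   are exactly the quaternion algebras over F. *)
Record quat (F : Type) (a b : F) := Quat { qre : F; qi : F; qj : F; qij : F }.
Arguments Quat {F a b}.

Section Quaternions.
Variables (F : comNzRingType) (a b : F).
Local Notation H := (quat a b).

Definition quat_prod (x : H) := (qre x, qi x, qj x, qij x).
Definition prod_quat (p : F * F * F * F) : H :=
  Quat p.1.1.1 p.1.1.2 p.1.2 p.2.
Lemma quat_prodK : cancel quat_prod prod_quat. Proof. by case. Qed.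
HB.instance Definition _ := Choice.copy H (can_type quat_prodK).

Definition quat_add (x y : H) : H :=
  Quat (qre x + qre y) (qi x + qi y) (qj x + qj y) (qij x + qij y).
Definition quat_opp (x : H) : H := Quat (- qre x) (- qi x) (- qj x) (- qij x).
Definition quat_scale (c : F) (x : H) : H :=
  Quat (c * qre x) (c * qi x) (c * qj x) (c * qij x).
Definition quat_mul (x y : H) : H :=
  Quat (qre x * qre y + a * (qi x * qi y) + b * (qj x * qj y)
          - a * b * (qij x * qij y))
       (qre x * qi y + qi x * qre y - b * (qj x * qij y) + b * (qij x * qj y))
       (qre x * qj y + qj x * qre y + a * (qi x * qij y) - a * (qij x * qi y))
       (qre x * qij y + qij x * qre y + qi x * qj y - qj x * qi y).

Local Ltac quat_tac :=
  repeat (case=> ? ? ? ?) => //=; rewrite /quat_add /quat_opp /quat_mul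
    /quat_scale /=; congr Quat; ring.

Fact quat_addA : associative quat_add. Proof. by quat_tac. Qed.
Fact quat_addC : commutative quat_add. Proof. by quat_tac. Qed.
Fact quat_add0 : left_id (Quat 0 0 0 0) quat_add. Proof. by quat_tac. Qed.
Fact quat_addN : left_inverse (Quat 0 0 0 0) quat_opp quat_add.
Proof. by quat_tac. Qed.
HB.instance Definition _ :=
  GRing.isZmodule.Build H quat_addA quat_addC quat_add0 quat_addN.

Fact quat_mulA : associative quat_mul. Proof. by quat_tac. Qed.
Fact quat_mul1l : left_id (Quat 1 0 0 0) quat_mul. Proof. by quat_tac. Qed.
Fact quat_mul1r : right_id (Quat 1 0 0 0) quat_mul. Proof. by quat_tac. Qed.
Fact quat_mulDl : left_distributive quat_mul quat_add.
Proof. by quat_tac. Qed.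
Fact quat_mulDr : right_distributive quat_mul quat_add.
Proof. by quat_tac. Qed.
Fact quat_1neq0 : (Quat 1 0 0 0 : H) != 0.
Proof. by apply/eqP => -[/eqP]; rewrite oner_eq0. Qed.
HB.instance Definition _ := GRing.Zmodule_isNzRing.Build H
  quat_mulA quat_mul1l quat_mul1r quat_mulDl quat_mulDr quat_1neq0.

Fact quat_scaleA (c d : F) (x : H) :
  quat_scale c (quat_scale d x) = quat_scale (c * d) x.
Proof. by move: x; quat_tac. Qed.
Fact quat_scale1 : left_id 1 quat_scale. Proof. by quat_tac. Qed.
Fact quat_scaleDr : right_distributive quat_scale +%R.
Proof.
move=> c [? ? ? ?] [? ? ? ?]; rewrite /quat_scale /=.
by congr Quat => /=; ring.
Qed.
Fact quat_scaleDl (x : H) : {morph quat_scale^~ x : c d / c + d}.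
Proof.
move=> c d; case: x => ? ? ? ?; rewrite /quat_scale /=.
by congr Quat => /=; ring.
Qed.
HB.instance Definition _ := GRing.Zmodule_isLmodule.Build F H
  quat_scaleA quat_scale1 quat_scaleDr quat_scaleDl.

Fact quat_scaleAl (c : F) (x y : H) : c *: (x * y) = (c *: x) * y.
Proof.
case: x y => [? ? ? ?] [? ? ? ?]; congr Quat => /=; ring.
Qed.
HB.instance Definition _ := GRing.Lmodule_isLalgebra.Build F H quat_scaleAl.
Fact quat_scaleAr (c : F) (x y : H) : c *: (x * y) = x * (c *: y).
Proof.
case: x y => [? ? ? ?] [? ? ? ?]; congr Quat => /=; ring.
Qed.
HB.instance Definition _ := GRing.Lalgebra_isAlgebra.Build F H quat_scaleAr.

Definition reduced_norm (x : H) : F :=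
  qre x ^+ 2 - a * qi x ^+ 2 - b * qj x ^+ 2 + a * b * qij x ^+ 2.

End Quaternions.

(* The canonical map (a, b / F) -> (a, b / F) (x)_f F' = (f a, f b / F') of
   extension of scalars along f : F -> F'. *)
Definition quat_ext (F F' : Type) (f : F -> F') (a b : F) (x : quat a b) :
    quat (f a) (f b) :=
  Quat (f (qre x)) (f (qi x)) (f (qj x)) (f (qij x)).

Definition ring_of_integers (k : fieldExtType rat) : set k :=
  [set x | integralOver (intr : int -> k) x].

Definition is_order (k : fieldExtType rat) (a b : k) (O : set (quat a b)) :
    Prop :=
  [/\ O 1,
      (forall x y, O x -> O y -> O (x - y) /\ O (x * y)),
      (exists (n : nat) (e : 'I_n -> quat a b),
         O = [set x | exists2 c : 'I_n -> k,
                (forall i, ring_of_integers (c i)) & x = \sum_i c i *: e i]) &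
      (forall x, exists (n : nat) (c : 'I_n -> k) (e : 'I_n -> quat a b),
         (forall i, O (e i)) /\ x = \sum_i c i *: e i)].

Section PSL2.
Variable R : realType.
Local Notation C := R[i].
Local Notation Re := (@complex.Re R).
Local Notation Im := (@complex.Im R).

Definition SL2 : Type := {A : 'M[C]_2 | \det A == 1}.
HB.instance Definition _ := Choice.on SL2.
HB.instance Definition _ := SubType.on SL2.

Lemma SL2_det (A : SL2) : \det (val A) = 1. Proof. exact/eqP/(valP A). Qed.
Lemma SL2_unit (A : SL2) : val A \in unitmx.
Proof. by rewrite unitmxE SL2_det unitr1. Qed.

Fact SL2_det1 : \det (1%:M : 'M[C]_2) == 1. Proof. by rewrite det1. Qed.
Fact SL2_detM (A B : SL2) : \det (val A *m val B) == 1.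
Proof. by rewrite det_mulmx !SL2_det mulr1. Qed.
Fact SL2_detV (A : SL2) : \det (invmx (val A)) == 1.
Proof. by rewrite det_inv SL2_det invr1. Qed.

Definition SL2_one : SL2 := Sub 1%:M SL2_det1.
Definition SL2_mul (A B : SL2) : SL2 := Sub (val A *m val B) (SL2_detM A B).
Definition SL2_inv (A : SL2) : SL2 := Sub (invmx (val A)) (SL2_detV A).

Fact SL2_mulA : associative SL2_mul.
Proof. by move=> A B D; apply: val_inj; rewrite /= mulmxA. Qed.
Fact SL2_mul1 : left_id SL2_one SL2_mul.
Proof. by move=> A; apply: val_inj; rewrite /= mul1mx. Qed.
Fact SL2_mul1r : right_id SL2_one SL2_mul.
Proof. by move=> A; apply: val_inj; rewrite /= mulmx1. Qed.
Fact SL2_mulV : left_inverse SL2_one SL2_inv SL2_mul.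
Proof. by move=> A; apply: val_inj; rewrite /= mulVmx ?SL2_unit. Qed.
Fact SL2_mulVr : right_inverse SL2_one SL2_inv SL2_mul.
Proof. by move=> A; apply: val_inj; rewrite /= mulmxV ?SL2_unit. Qed.
HB.instance Definition _ := isGroup.Build SL2
  SL2_mulA SL2_mul1 SL2_mul1r SL2_mulV SL2_mulVr.

Definition eq_up_to_sign (A B : SL2) : bool :=
  (val A == val B) || (val A == - val B).
Fact eq_up_to_sign_refl : reflexive eq_up_to_sign.
Proof. by move=> A; rewrite /eq_up_to_sign eqxx. Qed.
Fact eq_up_to_sign_sym : symmetric eq_up_to_sign.
Proof.
move=> A B; rewrite /eq_up_to_sign eq_sym; congr orb.
by rewrite -eqr_oppLR eq_sym.
Qed.
Fact eq_up_to_sign_trans : transitive eq_up_to_sign.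
Proof.
move=> B A D; rewrite /eq_up_to_sign.
by move=> /orP[]/eqP-> /orP[]/eqP->; rewrite ?opprK eqxx ?orbT.
Qed.
Canonical eq_up_to_sign_equiv := EquivRel eq_up_to_sign
  eq_up_to_sign_refl eq_up_to_sign_sym eq_up_to_sign_trans.

Definition PSL2 : Type := {eq_quot eq_up_to_sign}%qT.
HB.instance Definition _ := Choice.on PSL2.
HB.instance Definition _ := EqQuotient.on PSL2.

Definition toPSL2 (A : SL2) : PSL2 := (\pi_PSL2 A)%qT.

Lemma toPSL2_eqP (A B : SL2) :
  reflect (toPSL2 A = toPSL2 B) (eq_up_to_sign A B).
Proof. exact: (iffP (eqmodP _ A B)). Qed.

Lemma toPSL2K (x : PSL2) : toPSL2 (repr x) = x. Proof. exact: reprK. Qed.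

Definition PSL2_one : PSL2 := toPSL2 1%g.
Definition PSL2_mul (x y : PSL2) : PSL2 := toPSL2 (repr x * repr y)%g.
Definition PSL2_inv (x : PSL2) : PSL2 := toPSL2 (repr x)^-1%g.

Fact toPSL2M (A B : SL2) : PSL2_mul (toPSL2 A) (toPSL2 B) = toPSL2 (A * B)%g.
Proof.
apply/toPSL2_eqP; move/toPSL2_eqP: (toPSL2K (toPSL2 A)).
move/toPSL2_eqP: (toPSL2K (toPSL2 B)); rewrite /eq_up_to_sign /=.
by move=> /orP[]/eqP-> /orP[]/eqP->;
  rewrite ?mulmxN ?mulNmx ?opprK eqxx ?orbT.
Qed.

Fact toPSL2V (A : SL2) : PSL2_inv (toPSL2 A) = toPSL2 A^-1%g.
Proof.
apply/toPSL2_eqP; move/toPSL2_eqP: (toPSL2K (toPSL2 A)).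
rewrite /eq_up_to_sign /= => /orP[]/eqP->; first by rewrite eqxx.
by rewrite -scaleN1r invmxZ ?unitmxZ ?unitrN1 ?SL2_unit // invrN1 scaleN1r eqxx orbT.
Qed.

Fact PSL2_mulA : associative PSL2_mul.
Proof.
by move=> x y z; rewrite -(toPSL2K x) -(toPSL2K y) -(toPSL2K z) !toPSL2M mulgA.
Qed.
Fact PSL2_mul1 : left_id PSL2_one PSL2_mul.
Proof. by move=> x; rewrite -(toPSL2K x) toPSL2M mul1g. Qed.
Fact PSL2_mul1r : right_id PSL2_one PSL2_mul.
Proof. by move=> x; rewrite -(toPSL2K x) toPSL2M mulg1. Qed.
Fact PSL2_mulV : left_inverse PSL2_one PSL2_inv PSL2_mul.
Proof. by move=> x; rewrite -(toPSL2K x) toPSL2V toPSL2M mulVg. Qed.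
Fact PSL2_mulVr : right_inverse PSL2_one PSL2_inv PSL2_mul.
Proof. by move=> x; rewrite -(toPSL2K x) toPSL2V toPSL2M mulgV. Qed.
HB.instance Definition _ := isGroup.Build PSL2
  PSL2_mulA PSL2_mul1 PSL2_mul1r PSL2_mulV PSL2_mulVr.

(* The quotient of the subspace topology of SL(2,C) in M(2,C). *)
Definition open_PSL2 (U : set PSL2) : Prop :=
  exists2 V : set 'M[C^o]_2, open V & forall A : SL2, V (val A) <-> U (toPSL2 A).

Definition discrete_set (D : set PSL2) : Prop :=
  forall x, D x -> exists2 U, open_PSL2 U & U `&` D = [set x].

Definition kleinian (D : set PSL2) : Prop :=
  [/\ is_subgroup D, discrete_set D &
      ~ exists2 K, finite_index_subgroup K D & abelian_set K].

(* The sphere at infinity of hyperbolic 3-space is the Riemann sphere, None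
   being the point at infinity, and PSL(2,C) acts on it by Moebius maps. *)
Definition moebius (A : 'M[C]_2) (z : option C) : option C :=
  let: (a, b, c, d) := (A 0 0, A 0 1, A 1 0, A 1 1) in
  match z with
  | Some w => if c * w + d == 0 then None else Some ((a * w + b) / (c * w + d))
  | None => if c == 0 then None else Some (a / c)
  end.

Definition act (g : PSL2) (z : option C) : option C :=
  moebius (val (repr g)) z.

Lemma act_toPSL2 (A : SL2) z : act (toPSL2 A) z = moebius (val A) z.
Proof.
rewrite /act; move/toPSL2_eqP: (toPSL2K (toPSL2 A)).
rewrite /eq_up_to_sign => /orP[]/eqP-> //.
rewrite /moebius; case: z => [w|]; rewrite !mxE.
  by rewrite !mulNr -!opprD oppr_eq0 invrN mulrNN.
by rewrite oppr_eq0 invrN mulrNN.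
Qed.

(* An oriented hyperbolic line is given by its initial and terminal
   endpoints on the sphere at infinity. *)
Record oriented_line := OrientedLine {
  init : option C; term : option C; init_neq_term : init != term }.

Definition maps_line (g : PSL2) (m : oriented_line) (u v : option C) : Prop :=
  act g (init m) = u /\ act g (term m) = v.

(* After an isometry taking m to the line from 0 to oo, g is the rotation by
   pi about that line, i.e. z |-> - z. *)
Definition half_turn (g : PSL2) (m : oriented_line) : Prop :=
  exists2 h : PSL2, maps_line h m (Some 0) None &
    forall z, act (h * g * h^-1)%g (Some z) = Some (- z).

Definition cexp (z : C) : C :=
  (expR (Re z) * cos (Im z) +i* (expR (Re z) * sin (Im z)))%C.

(* For lines with no common endpoint, normalise by an isometry so that the
   common perpendicular lies on the line from 0 to oo and m1 is the line from
   -1 to 1, which meets it at height 1.  The screw motion z |-> cexp mu * z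
   along the perpendicular, with translation length x and rotation angle y for
   mu = x + iy, then takes m1 to m2.  For intersecting lines (x = 0) both y and
   2 pi - y are allowed, the perpendicular having no preferred direction.
   Lines sharing an endpoint have x = 0 and angle 0 or pi according to the
   orientations. *)
Definition complex_distance (m1 m2 : oriented_line) (mu : C) : Prop :=
  [/\ 0 <= Re mu, 0 <= Im mu < 2 * pi &
      [\/ exists2 g : PSL2, maps_line g m1 (Some (- 1)) (Some 1) &
            maps_line g m2 (Some (- cexp mu)) (Some (cexp mu)),
          mu = 0 /\ (init m1 = init m2 \/ term m1 = term m2) |
          mu = (0 +i* pi)%C /\ (init m1 = term m2 \/ term m1 = init m2)]].

Definition regular_triangle_group (D : set PSL2) : Prop :=
  exists (a b c : PSL2) (ma mb mc : oriented_line) (mu : C),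
    [/\ D = generated [set a; b; c],
        [/\ half_turn a ma, half_turn b mb & half_turn c mc] &
        [/\ complex_distance ma mb mu, complex_distance ma mc mu &
            complex_distance mc mb mu]].

Definition one_complex_place (k : fieldExtType rat)
    (iota : {rmorphism k -> C}) : Prop :=
  (exists x, Im (iota x) != 0) /\
  forall tau : {rmorphism k -> C}, (exists x, Im (tau x) != 0) ->
    tau =1 iota \/ tau =1 (fun x => conjc (iota x)).

(* p(O^1) for the identification Phi of A (x)_k C with M(2,C). *)
Definition norm1_image (k : fieldExtType rat) (iota : {rmorphism k -> C})
    (a b : k) (Phi : quat (iota a) (iota b) -> 'M[C]_2)
    (O : set (quat a b)) : set PSL2 :=
  [set toPSL2 A | A in
    [set A : SL2 | exists x,
       [/\ O x, reduced_norm x = 1 & val A = Phi (quat_ext iota x)]]].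

(* Here k is viewed inside C through iota, A = (a, b / k), and (-1, -1 / R) is
   the algebra of Hamilton quaternions. *)
Definition arithmetic_group (D : set PSL2) : Prop :=
  is_subgroup D /\
  exists (k : fieldExtType rat) (iota : {rmorphism k -> C}) (a b : k)
         (Phi : {lrmorphism quat (iota a) (iota b) -> 'M[C]_2})
         (O : set (quat a b)),
    [/\ one_complex_place iota,
        a != 0 /\ b != 0,
        (forall phi : {rmorphism k -> R},
           exists Psi : {lrmorphism quat (phi a) (phi b) -> quat (-1 : R) (-1)},
             bijective Psi),
        bijective Phi &
        is_order O /\ commensurable D (norm1_image Phi O)].

Definition nearly_arithmetic (D : set PSL2) : Prop :=
  [/\ is_subgroup D,
      (exists E, [/\ arithmetic_group E, kleinian E & D `<=` E]) &
      ~ free_product_of_cyclics D].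

End PSL2.

(* Main.v *)
(* A regular triangle group is generated by half-turns with matrix lifts A, B, M
   such that tr AB = tr AM = tr MB = - t, where t = 2 cosh mu.  For t = 2 the
   three axes have a common endpoint and the group is virtually abelian; for
   every other t the triple has a normal form depending only on t and on the
   choice of a square root, so it suffices to bound the set of traces t.
   - If |t| >= 5, a ping-pong argument in coordinates with respect to A, B, M
     shows that the group is the free product of three groups of order two.
   - If the group lies in an arithmetic group with trace field k, then t is an
     algebraic integer, each half-turn is a scalar multiple of an element of the
     quaternion algebra, and hence t lies in k.  At a real place phi the algebra
     is definite, and the Gram determinant of the three axes, which is
     (1 - r)^2 (1 + 2 r) for r = phi(t) / 2, is nonnegative: phi(t) lies in
     [-1, 2], an interval of length less than 4.
   - With y = x^2 - x the integer polynomial y (y - 1) (y - 2) is at most 3/4 in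
     absolute value on [-1, 2].  Its norm at t is an integer, so either it
     vanishes at t or the degree of t is bounded; the conjugates of t being
     bounded too, finitely many t remain. *)

From HB Require Import structures.
Require Import Defs.
From mathcomp Require Import all_boot all_order all_algebra all_field.
From mathcomp Require Import ring lra zify.
From mathcomp Require Import complex.
From mathcomp Require Import all_classical all_reals all_analysis.

Set Implicit Arguments.
Unset Strict Implicit.
Unset Printing Implicit Defensive.

Import Order.TTheory GRing.Theory Num.Theory.

Local Open Scope classical_set_scope.
Local Open Scope ring_scope.

(** * Subgroups of finite index *)

(** Length 4 is Fekete's threshold: an interval of length below 4 has capacity below 1, so some
    nonzero integer polynomial has sup norm below 1 on it; [small_poly] is an explicit one. As k has
    a single complex place, only t and its complex conjugate can leave the interval, and there
    [small_poly] is bounded because |t| <= 5. The norm is then at most a constant times a power of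
    3/4, which bounds the degree.

    That a half-turn is proportional to a quaternion over k comes from commensurability: the
    elements which, together with their conjugates by the half-turn, come from the order form a
    subgroup of finite index. Their quaternions span the algebra over k, so conjugation by the
    half-turn preserves it. Spanning needs irreducibility of subgroups of finite index, and here
    being nonelementary enters: a point at infinity fixed by such a subgroup would be fixed by the
    whole group, and half-turns with a common fixed point generate a virtually abelian group. *)

Section FiniteIndex.
Variable G : groupType.
Implicit Types (H K : set G).
Local Open Scope group_scope.

(** Finite index is handled through maps to a finite type whose fibres lie in cosets;
    [finite_index_ord] gives such a map back. Intersecting subgroups then amounts to pairing
    maps. *)
Lemma finite_index_of_inv (T : finType) H K (f : G -> T) :
  is_subgroup H -> H `<=` K ->
  (forall x y, K x -> K y -> f x = f y -> H (x^-1 * y)) ->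
  finite_index_subgroup H K.
Proof.
move=> sH sHK Hf; split=> //.
pose rep t : G := xget 1 [set x | K x /\ f x = t].
exists [seq rep t | t : T] => x Kx.
have [Kr fr] : [set y | K y /\ f y = f x] (rep (f x)) by apply: (@xgetI _ _ _ x).
exists (rep (f x)); last exact: Hf.
by apply/mapP; exists (f x); rewrite ?mem_enum.
Qed.

Lemma subgroup_expg H x n : is_subgroup H -> H x -> H (x ^+ n).
Proof.
move=> [H1 HM HV] Hx; elim: n => [|n IH]; first by rewrite expg0.
by rewrite expgS; apply: HM.
Qed.

Lemma subgroup_div H x y : is_subgroup H -> H x -> H y -> H (x^-1 * y).
Proof. by move=> [H1 HM HV] Hx Hy; apply: HM => //; apply: HV. Qed.

Lemma finite_index_ord H K : finite_index_subgroup H K ->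
  exists (n : nat) (f : G -> 'I_n.+1),
    forall x y, K x -> K y -> f x = f y -> H (x^-1 * y).
Proof.
case=> -[H1 HM HV] sHK [s Hs]; exists (size s).
pose P x i := (i < size s)%N /\ H ((nth 1 s i)^-1 * x).
(* One value more than the length of s keeps the codomain inhabited, so that [ord0] can serve
   outside K. *)
have /choice[f Hf] : forall x, exists i : 'I_(size s).+1, K x -> P x i.
  move=> x; have [Kx|nKx] := pselect (K x); last by exists ord0.
  have [r rs Hr] := Hs x Kx.
  have lt : (index r s < size s)%N by rewrite index_mem.
  by exists (inord (index r s)) => _; rewrite /P inordK ?nth_index // ltnS ltnW.
exists f => x y Kx Ky fxy.
have [_ Hx] := Hf x Kx; have [_ Hy] := Hf y Ky.
move: Hy; rewrite -fxy => Hy.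
rewrite (_ : x^-1 * y = ((nth 1 s (f x))^-1 * x)^-1 * ((nth 1 s (f x))^-1 * y)).
  exact: subgroup_div.
by rewrite invgM invgK -mulgA mulVKg.
Qed.

Lemma finite_index_expg H K x : is_subgroup K -> finite_index_subgroup H K ->
  K x -> exists n, H (x ^+ n.+1).
Proof.
move=> sK HK Kx; have [n [f Hf]] := finite_index_ord HK.
have : ~~ injectiveb (fun i : 'I_n.+2 => f (x ^+ i)).
  apply/negP => /injectiveP /leq_card; rewrite !card_ord; lia.
move=> /injectivePn[i [j ij fij]].
wlog lt : i j ij fij / (i < j)%N.
  move=> W; case: (ltngtP i j) => [||e]; [exact: W| |].
    by apply: W => //; rewrite eq_sym.
  by move: ij; rewrite (val_inj e) eqxx.
exists (j - i).-1; rewrite prednK ?subn_gt0 //.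
have := Hf _ _ (subgroup_expg i sK Kx) (subgroup_expg j sK Kx) fij.
by rewrite -{1}(subnKC (ltnW lt)) expgnDr mulKg.
Qed.

(** Needed for H coming from an order: on this subgroup both x and its conjugate by g are
    represented by quaternions over k. *)
Lemma finite_index_conj H E K g : finite_index_subgroup H E ->
  is_subgroup E -> is_subgroup K -> K `<=` E -> E g ->
  finite_index_subgroup [set x | [/\ K x, H x & H (g * x * g^-1)]] K.
Proof.
move=> HE sE sK sKE Eg; have [n [f Hf]] := finite_index_ord HE.
case: (sE) => E1 EM EV; case: (sK) => K1 KM KV.
case: HE => -[H1 HM HV] sHE _.
apply: (@finite_index_of_inv _ _ _ (fun x => (f x, f (g * x * g^-1)))).
- split.
  + by split; rewrite // mulg1 mulgV.
  + move=> x y [Kx Hx Gx] [Ky Hy Gy]; split; [exact: KM|exact: HM|].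
    have -> : g * (x * y) * g^-1 = (g * x * g^-1) * (g * y * g^-1).
      by rewrite !mulgA mulgVK.
    exact: HM.
  + move=> x [Kx Hx Gx]; split; [exact: KV|exact: HV|].
    have -> : g * x^-1 * g^-1 = (g * x * g^-1)^-1 by rewrite !invgM invgK mulgA.
    exact: HV.
- by move=> x [].
- move=> x y Kx Ky [e1 e2]; split; first exact: subgroup_div.
    by apply: Hf => //; apply: sKE.
  have EJ u : K u -> E (g * u * g^-1) by move=> /sKE Eu; apply: (EM _ _ (EM _ _ Eg Eu) (EV _ Eg)).
  have := Hf _ _ (EJ x Kx) (EJ y Ky) e2.
  by rewrite !invgM invgK !mulgA mulgVK.
Qed.

Lemma generated_subgroup (S : set G) : is_subgroup (generated S).
Proof.
split=> [A [[]] //|x y Sx Sy A AS|x Sx A AS]; move: (AS) => [[A1 AM AV] SA].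
  by apply: AM; [exact: Sx|exact: Sy].
by apply: AV; exact: Sx.
Qed.

Lemma sub_generated (S : set G) : S `<=` generated S.
Proof. by move=> x Sx A [_ SA]; exact: SA. Qed.

Lemma generated_sub (S H : set G) : is_subgroup H -> S `<=` H -> generated S `<=` H.
Proof. by move=> sH SH x; apply; split. Qed.

End FiniteIndex.

(** * Free products of groups of order two *)

Section FreeProduct.
Variables (G : groupType) (I : eqType) (g : I -> G).
Local Open Scope group_scope.

(** A factor generated by an involution has at most one nontrivial element, so a reduced word is
    determined by its indices. *)
Lemma free_product_of_involutions :
  (forall i, g i * g i = 1) ->
  (forall s : seq I, s != [::] -> sorted (fun i j => i != j) s ->
     \prod_(i <- s) g i <> 1) ->
  free_product_of_cyclics (generated (range g)).
Proof.
move=> gK Hs.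
have gV i : (g i)^-1 = g i by rewrite -[LHS]mulg1 -(gK i) mulKg.
have Hg i x : generated [set g i] x -> x <> 1 -> x = g i.
  suff: generated [set g i] `<=` [set x | x = 1 \/ x = g i] by move=> /[apply] -[].
  apply: generated_sub; last by move=> _ ->; right.
  split=> [|y z|y]; first by left.
    by move=> [->|->] [->|->]; rewrite ?mul1g ?mulg1 ?gK; [left|right|right|left].
  by move=> [->|->]; rewrite ?invg1 ?gV; [left|right].
exists I, (fun i => generated [set g i]); split; first by move=> i; exists (g i).
split=> [i||w rw w0]; first exact: generated_subgroup.
- apply/seteqP; split; apply: generated_sub; try exact: generated_subgroup.
    by move=> _ [i _ <-]; apply: sub_generated; exists i => //; exact: sub_generated.
  move=> y [i _]; apply: generated_sub; first exact: generated_subgroup.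
  by move=> _ ->; apply: sub_generated; exists i.
- have [e sw] : w = [seq (i, g i) | i <- map fst w] /\
      sorted (fun i j => i != j) (map fst w).
    elim: w rw {w0} => [|[i x] w IH] //= [Hx x1 /IH[{IH}e sw] Hw].
    split; first by rewrite (Hg _ _ Hx x1) -e.
    by case: w Hw sw {e} => [|[j y] w] //= ij ->; rewrite andbT; apply/eqP.
  rewrite e big_map; apply: Hs => //.
  by case: w w0 {rw e sw}.
Qed.

End FreeProduct.

(** * Two by two matrices *)

Definition mx2 (F : pzRingType) (a b c d : F) : 'M[F]_2 :=
  \matrix_(i, j) if i == 0 then (if j == 0 then a else b)
                 else (if j == 0 then c else d).
Definition cv2 (F : pzRingType) (a b : F) : 'cV[F]_2 :=
  \col_i if i == 0 then a else b.

Section Mx2.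
Variable F : comNzRingType.
Implicit Types (A B : 'M[F]_2).

Lemma ord2 (P : 'I_2 -> Prop) : P 0 -> P 1 -> forall i, P i.
Proof.
move=> P0 P1 [[|[|//]] Hi].
  by rewrite (_ : Ordinal Hi = 0) //; apply/val_inj.
by rewrite (_ : Ordinal Hi = 1) //; apply/val_inj.
Qed.

Lemma mx2E A : A = mx2 (A 0 0) (A 0 1) (A 1 0) (A 1 1).
Proof. by apply/matrixP; elim/ord2; elim/ord2; rewrite mxE. Qed.

Lemma cv2E (v : 'cV[F]_2) : v = cv2 (v 0 0) (v 1 0).
Proof. by apply/colP; elim/ord2; rewrite mxE. Qed.

Lemma mx2_ind (P : 'M[F]_2 -> Prop) :
  (forall a b c d, P (mx2 a b c d)) -> forall A, P A.
Proof. by move=> H A; rewrite (mx2E A). Qed.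

Lemma cv2_ind (P : 'cV[F]_2 -> Prop) :
  (forall a b, P (cv2 a b)) -> forall v, P v.
Proof. by move=> H v; rewrite (cv2E v). Qed.

Lemma mx2_mul (a b c d a' b' c' d' : F) :
  mx2 a b c d *m mx2 a' b' c' d' =
  mx2 (a * a' + b * c') (a * b' + b * d') (c * a' + d * c') (c * b' + d * d').
Proof.
by apply/matrixP; elim/ord2; elim/ord2;
   rewrite !mxE !big_ord_recr big_ord0 /= !mxE /= add0r.
Qed.

Lemma mx2_mulcv (a b c d x y : F) :
  mx2 a b c d *m cv2 x y = cv2 (a * x + b * y) (c * x + d * y).
Proof.
by apply/colP; elim/ord2; rewrite !mxE !big_ord_recr big_ord0 /= !mxE /= add0r.
Qed.

Lemma mx2_add (a b c d a' b' c' d' : F) :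
  mx2 a b c d + mx2 a' b' c' d' = mx2 (a + a') (b + b') (c + c') (d + d').
Proof. by apply/matrixP; elim/ord2; elim/ord2; rewrite !mxE. Qed.

Lemma mx2_opp (a b c d : F) : - mx2 a b c d = mx2 (- a) (- b) (- c) (- d).
Proof. by apply/matrixP; elim/ord2; elim/ord2; rewrite !mxE. Qed.

Lemma mx2_scale (k a b c d : F) :
  k *: mx2 a b c d = mx2 (k * a) (k * b) (k * c) (k * d).
Proof. by apply/matrixP; elim/ord2; elim/ord2; rewrite !mxE. Qed.

Lemma mx2_scalar (a : F) : a%:M = mx2 a 0 0 a.
Proof. by apply/matrixP; elim/ord2; elim/ord2; rewrite !mxE. Qed.

Lemma mx2_0 : 0 = mx2 0 0 0 0 :> 'M[F]_2.
Proof. by apply/matrixP; elim/ord2; elim/ord2; rewrite !mxE. Qed.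

Lemma cv2_scale (k a b : F) : k *: cv2 a b = cv2 (k * a) (k * b).
Proof. by apply/colP; elim/ord2; rewrite !mxE. Qed.

Lemma cv2_add (a b a' b' : F) : cv2 a b + cv2 a' b' = cv2 (a + a') (b + b').
Proof. by apply/colP; elim/ord2; rewrite !mxE. Qed.

Lemma cv2_opp (a b : F) : - cv2 a b = cv2 (- a) (- b).
Proof. by apply/colP; elim/ord2; rewrite !mxE. Qed.

Lemma cv2_0 : 0 = cv2 0 0 :> 'cV[F]_2.
Proof. by apply/colP; elim/ord2; rewrite !mxE. Qed.

Lemma mx2_tr (a b c d : F) : \tr (mx2 a b c d) = a + d.
Proof. by rewrite /mxtrace big_ord_recr big_ord_recr big_ord0 /= !mxE /= add0r. Qed.

Lemma mx2_det (a b c d : F) : \det (mx2 a b c d) = a * d - b * c.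
Proof.
rewrite (expand_det_row _ 0) !big_ord_recr big_ord0 /= add0r /cofactor.
by rewrite !det_mx11 !mxE /= expr0 expr1 !mul1r mulN1r mulrN.
Qed.

Definition mx2_simpl := (mx2_mul, mx2_mulcv, mx2_add, mx2_opp, mx2_scale,
  mx2_scalar, mx2_0, cv2_scale, cv2_add, cv2_opp, cv2_0, mx2_tr, mx2_det).

Lemma cv2_inj (a b a' b' : F) : cv2 a b = cv2 a' b' -> a = a' /\ b = b'.
Proof. by move=> /colP e; have := (e 0, e 1); rewrite !mxE /= => -[]. Qed.

Lemma mx2_cayley A : A *m A = \tr A *: A - (\det A)%:M.
Proof. by elim/mx2_ind: A => a b c d; rewrite !mx2_simpl; congr mx2; ring. Qed.

(** Cayley-Hamilton polarised. For trace zero matrices the right side is scalar, which is how traces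
    of products enter computations with half-turns. *)
Lemma mx2_polar A B : A *m B + B *m A =
  \tr A *: B + \tr B *: A + (\tr (A *m B) - \tr A * \tr B)%:M.
Proof.
elim/mx2_ind: A => a b c d; elim/mx2_ind: B => a' b' c' d'.
by rewrite !mx2_simpl; congr mx2; ring.
Qed.

Lemma mx2_sqr A : \tr A = 0 -> \det A = 1 -> A *m A = - 1%:M.
Proof. by move=> t d; rewrite mx2_cayley t d scale0r sub0r. Qed.

Lemma mx2_anticomm A B t : \tr A = 0 -> \tr B = 0 -> \tr (A *m B) = t ->
  B *m A = t%:M - A *m B.
Proof.
move=> a b <-; apply/(addrI (A *m B)); rewrite mx2_polar a b !scale0r mul0r.
by rewrite subr0 !add0r addrC subrK.
Qed.

End Mx2.

Lemma cv2_dep (F : fieldType) (v : 'rV[F]_2) (u w : 'cV[F]_2) : v != 0 -> u != 0 ->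
  v *m u = 0 -> v *m w = 0 -> exists c, w = c *: u.
Proof.
have [{}v ->] : exists v', v = v'^T by exists v^T; rewrite trmxK.
rewrite trmx_eq0; elim/cv2_ind: v => p q; elim/cv2_ind: u => a b; elim/cv2_ind: w => a' b'.
move=> v0 u0 /matrixP/(_ 0 0); rewrite !mxE !big_ord_recr big_ord0 /= !mxE /= add0r => e.
move=> /matrixP/(_ 0 0); rewrite !mxE !big_ord_recr big_ord0 /= !mxE /= add0r => e'.
have D : a * b' = b * a'.
  have [p0|p0] := eqVneq p 0; last first.
    apply: (mulfI p0); apply/subr0_eq.
    transitivity (b' * (p * a + q * b) - b * (p * a' + q * b')); first by ring.
    by rewrite e e' !mulr0 subr0.
  have [q0|q0] := eqVneq q 0; first by move: v0; rewrite p0 q0 -cv2_0 eqxx.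
  apply: (mulfI q0); apply/subr0_eq.
  transitivity (a * (p * a' + q * b') - a' * (p * a + q * b)); first by ring.
  by rewrite e e' !mulr0 subr0.
have [a0|a0] := eqVneq a 0.
  have b0 : b != 0 by apply: contraNneq u0 => b0; rewrite a0 b0 -cv2_0.
  exists (b' / b); rewrite cv2_scale divfK // a0 mulr0; congr cv2.
  by apply: (mulfI b0); rewrite -D a0 mul0r mulr0.
exists (a' / a); rewrite cv2_scale divfK //; congr cv2.
by apply: (mulfI a0); rewrite D; field.
Qed.

(** * Burnside's theorem in dimension two *)

Section Burnside.
Variable F : closedFieldType.
Implicit Types (S : set 'M[F]_2).

Definition common_eigenvector S (v : 'cV[F]_2) : Prop :=
  v != 0 /\ forall X, S X -> exists c, X *m v = c *: v.

(* If T is invertible and c is an eigenvalue of a nonscalar X in S, then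
   T (X - c) is singular and annihilates S too.  A singular T has rank one, say
   T = u v, and then v kills S u, so that S preserves the line of u. *)
Lemma burnside2 S T : S 1%:M -> (forall X Y, S X -> S Y -> S (X *m Y)) ->
  T != 0 -> (forall X, S X -> \tr (T *m X) = 0) ->
  exists v, common_eigenvector S v.
Proof.
move=> S1 SM.
have singular U : U != 0 -> \det U = 0 -> (forall X, S X -> \tr (U *m X) = 0) ->
    exists v, common_eigenvector S v.
  move=> U0 dU HU.
  have : \rank U = 1%N.
    apply/eqP; rewrite eqn_leq lt0n mxrank_eq0 U0 andbT -ltnS ltn_neqAle rank_leq_row andbT.
    apply/eqP => r2; have : U \in unitmx by rewrite -row_free_unit /row_free r2.
    by rewrite unitmxE dU unitr0.
  move: (col_base U) (row_base U) (mulmx_base U) => u v; move: u v.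
  case: (\rank U) => [|[|]] // u v eU _.
  have u0 : u != 0 by apply: contraNneq U0 => u0; rewrite -eU u0 mul0mx.
  have v0 : v != 0 by apply: contraNneq U0 => v0; rewrite -eU v0 mulmx0.
  have vXu X : S X -> v *m (X *m u) = 0.
    move=> /HU; rewrite -eU -mulmxA mxtrace_mulC -mulmxA => e.
    by apply/matrixP => i j; rewrite !ord1 [RHS]mxE -e /mxtrace big_ord1.
  exists u; split=> // X SX.
  by apply: (cv2_dep v0 u0 _ (vXu X SX)); rewrite -[u]mul1mx; apply: vXu.
move=> T0 HT; have [uT|nuT] := boolP (T \in unitmx); last first.
  by apply: (singular T) => //; move: nuT; rewrite unitmxE unitfE negbK => /eqP.
have [sc|] := pselect (forall X, S X -> exists c, X = c%:M).
  exists (cv2 1 0); split.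
    by apply/eqP; rewrite cv2_0 => /cv2_inj[/eqP]; rewrite oner_eq0.
  by move=> X /sc[c ->]; exists c; rewrite mul_scalar_mx.
move=> /existsNP[X /not_implyP[SX nX]].
have [c rc] : exists c, root (char_poly X) c.
  by apply/closed_rootP; rewrite size_char_poly.
apply: (singular (T *m (X - c%:M))).
- apply: contra_notN nX => /eqP e; exists c; apply/eqP.
  by rewrite -subr_eq0 -(mulKmx uT (X - _)) e mulmx0.
- move: rc; rewrite -eigenvalue_root_char => /eigenvalueP[v /eqP].
  rewrite -subr_eq0 -mul_mx_scalar -mulmxBr => /eqP e v0.
  rewrite det_mulmx; apply/eqP; rewrite mulf_eq0; apply/orP; right.
  apply/det0P; exists v => //.
- move=> Y SY; rewrite -mulmxA mulmxBl mul_scalar_mx mulmxBr -scalemxAr.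
  by rewrite linearB linearZ /= !HT ?mulr0 ?subr0 //; apply: SM.
Qed.

End Burnside.

(** * Eigenvectors *)

Section Eigenvectors.
Variable F : fieldType.
Implicit Types (X Y N : 'M[F]_2) (v w : 'cV[F]_2).

Definition eigenvector X v := exists c, X *m v = c *: v.

Lemma eigenvectorM X Y v :
  eigenvector X v -> eigenvector Y v -> eigenvector (X *m Y) v.
Proof.
by move=> [c e] [d f]; exists (d * c); rewrite -mulmxA f -scalemxAr e scalerA.
Qed.

Lemma eigenvectorN X v : eigenvector X v -> eigenvector (- X) v.
Proof. by move=> [c e]; exists (- c); rewrite mulNmx e scaleNr. Qed.

Lemma eigenvectorV X v : X \in unitmx -> v != 0 ->
  eigenvector X v -> eigenvector (invmx X) v.
Proof.
move=> uX v0 [c e]; exists c^-1.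
have c0 : c != 0.
  by apply: contraNneq v0 => c0; rewrite -(mulKmx uX v) e c0 scale0r mulmx0.
by apply: (scalerI c0); rewrite scalerA mulfV // scale1r scalemxAr -e mulKmx.
Qed.

Lemma mx2_eq0 X v w : v != 0 -> ~ (exists c, w = c *: v) ->
  X *m v = 0 -> X *m w = 0 -> X = 0.
Proof.
move=> v0 nw ev ew; apply/row_matrixP => i; rewrite row0; apply/eqP.
apply: contra_notT nw => r0.
by apply: (cv2_dep r0 v0); rewrite -row_mul ?ev ?ew row0.
Qed.

(** N has rank one and its image equals its kernel; a matrix anticommuting with N preserves this
    line, which any nonzero column of N spans. *)
Lemma nilpotent_eigenvector N : N != 0 -> N *m N = 0 ->
  exists2 v, v != 0 & forall X, X *m N + N *m X = 0 -> eigenvector X v.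
Proof.
move=> N0 NN.
have /matrix0Pn[i [j nij]] := N0.
have cj : col j N != 0 by apply: contraNneq nij => /colP/(_ i); rewrite !mxE => ->.
have ri : row i N != 0 by apply: contraNneq nij => /rowP/(_ j); rewrite !mxE => ->.
exists (col j N) => // X /eqP; rewrite addr_eq0 => /eqP XN.
apply: (cv2_dep ri cj).
  by rewrite colE mulmxA -row_mul NN row0 mul0mx.
by rewrite colE mulmxA mulmxA -row_mul -[N *m X]opprK -XN -row_mul mulNmx -mulmxA NN mulmx0 oppr0 row0 mul0mx.
Qed.

End Eigenvectors.

(** * The case t = 2, and commuting unipotents *)

Section Parabolic.
Variable F : closedFieldType.
Implicit Types (A B C X Y : 'M[F]_2).

(** Here (A - B)^2 = A^2 + B^2 - (AB + BA) = -2 + 2 = 0, and similar sums show that A, B and C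
    anticommute with A - B. If A = B, the difference A - C takes over; if all three agree, any
    eigenvector will do. *)
Lemma regular_triple_eigenvector A B C :
  [/\ \tr A = 0, \tr B = 0 & \tr C = 0] ->
  [/\ \det A = 1, \det B = 1 & \det C = 1] ->
  [/\ \tr (A *m B) = - 2, \tr (A *m C) = - 2 & \tr (C *m B) = - 2] ->
  exists2 v, v != 0 & [/\ eigenvector A v, eigenvector B v & eigenvector C v].
Proof.
move=> [tA tB tC] [dA dB dC] [AB AC CB].
have m2 : (- 2)%:M = - 1%:M - 1%:M :> 'M[F]_2 by rewrite -opprD -raddfD /= -raddfN.
have A2 := mx2_sqr tA dA; have B2 := mx2_sqr tB dB; have C2 := mx2_sqr tC dC.
have BA := mx2_anticomm tA tB AB; have CA := mx2_anticomm tA tC AC.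
have BC := mx2_anticomm tC tB CB.
have [eAB|nAB] := eqVneq (A - B) 0; last first.
  have [|v v0 Hv] := nilpotent_eigenvector nAB.
    rewrite mulmxBl !mulmxBr A2 B2 BA m2.
    by move: (A *m B) => U; apply/matrixP => i j; rewrite !mxE; ring.
  exists v => //; split; apply: Hv; rewrite mulmxBl !mulmxBr ?A2 ?B2 ?BA ?CA ?BC m2.
  - by move: (A *m B) => U; apply/matrixP => i j; rewrite !mxE; ring.
  - by move: (A *m B) => U; apply/matrixP => i j; rewrite !mxE; ring.
  - by move: (A *m C) (C *m B) => U V; apply/matrixP => i j; rewrite !mxE; ring.
move/subr0_eq: eAB => eAB; rewrite -eAB.
have [eAC|nAC] := eqVneq (A - C) 0; last first.
  have [|v v0 Hv] := nilpotent_eigenvector nAC.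
    rewrite mulmxBl !mulmxBr A2 C2 CA m2.
    by move: (A *m C) => U; apply/matrixP => i j; rewrite !mxE; ring.
  have HA : eigenvector A v.
    apply: Hv; rewrite mulmxBl !mulmxBr A2 CA m2.
    by move: (A *m C) => U; apply/matrixP => i j; rewrite !mxE; ring.
  exists v => //; split=> //; apply: Hv; rewrite mulmxBl !mulmxBr C2 CA m2.
  by move: (A *m C) => U; apply/matrixP => i j; rewrite !mxE; ring.
move/subr0_eq: eAC => <-.
have [c] : exists c, root (char_poly A^T) c.
  by apply/closed_rootP; rewrite size_char_poly.
rewrite -eigenvalue_root_char => /eigenvalueP[v e v0].
have : eigenvector A v^T.
  by exists c; rewrite -[A]trmxK -trmx_mul e; apply/matrixP => i j; rewrite !mxE.
by exists v^T; rewrite ?trmx_eq0.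
Qed.

(** X - 1 and Y - 1 are nilpotent and kill v; such matrices form a line, so the two are
    proportional. *)
Lemma unipotent_comm X Y v : v != 0 -> \det X = 1 -> \det Y = 1 ->
  X *m (v : 'cV_2) = v -> Y *m v = v -> X *m Y = Y *m X.
Proof.
elim/mx2_ind: X => a b c d; elim/mx2_ind: Y => a' b' c' d'.
elim/cv2_ind: v => p q v0; rewrite !mx2_simpl => dX dY.
(* X - 1 is singular, and det (X - 1) = 2 - tr X. *)
have tr2 x y z t : x * t - y * z = 1 -> x * p + y * q = p ->
    z * p + t * q = q -> x + t = 2.
  move=> D e1 e2; apply/eqP; rewrite -subr_eq0; apply/eqP.
  have E : (x - 1) * (t - 1) - y * z = 2 - (x + t).
    by transitivity (x * t - y * z + 1 - (x + t)); [ring|rewrite D; ring].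
  have Ep : p * ((x - 1) * (t - 1) - y * z) = 0.
    transitivity ((t - 1) * (x * p + y * q - p) - y * (z * p + t * q - q)); first by ring.
    by rewrite e1 e2 !subrr !mulr0 subrr.
  have Eq : q * ((x - 1) * (t - 1) - y * z) = 0.
    transitivity ((x - 1) * (z * p + t * q - q) - z * (x * p + y * q - p)); first by ring.
    by rewrite e1 e2 !subrr !mulr0 subrr.
  rewrite -opprB -E; apply/eqP; rewrite oppr_eq0; apply: contraNT v0 => n0.
  move/eqP: Ep; move/eqP: Eq; rewrite !mulf_eq0 (negPf n0) !orbF => /eqP-> /eqP->.
  by rewrite cv2_0.
move=> /cv2_inj[e1 e2] /cv2_inj[e1' e2'].
have ed : d = 2 - a by rewrite -(tr2 _ _ _ _ dX e1 e2) addrAC subrr add0r.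
have ed' : d' = 2 - a' by rewrite -(tr2 _ _ _ _ dY e1' e2') addrAC subrr add0r.
subst d d'.
have f1 : (a - 1) * p + b * q = 0 by rewrite mulrBl mul1r addrAC e1 subrr.
have f1' : (a' - 1) * p + b' * q = 0 by rewrite mulrBl mul1r addrAC e1' subrr.
have f2 : c * p - (a - 1) * q = 0.
  by transitivity (c * p + (2 - a) * q - q); [ring|rewrite e2 subrr].
have f2' : c' * p - (a' - 1) * q = 0.
  by transitivity (c' * p + (2 - a') * q - q); [ring|rewrite e2' subrr].
(* The minors that express proportionality of X - 1 and Y - 1. *)
have [D1 D2 D3] : [/\ (a - 1) * b' = (a' - 1) * b, c * (a' - 1) = c' * (a - 1)
    & b * c' = b' * c].
  have [p0|p0] := eqVneq p 0.
    have q0 : q != 0 by apply: contraNneq v0 => q0; rewrite p0 q0 -cv2_0.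
    move: f1 f1' f2 f2'; rewrite p0 !mulr0 !add0r => /eqP; rewrite mulf_eq0 (negPf q0) orbF => /eqP->.
    move=> /eqP; rewrite mulf_eq0 (negPf q0) orbF => /eqP->.
    move=> /eqP; rewrite oppr_eq0 mulf_eq0 (negPf q0) orbF => /eqP->.
    move=> /eqP; rewrite oppr_eq0 mulf_eq0 (negPf q0) orbF => /eqP->.
    by rewrite !mulr0 !mul0r.
  have D1 : (a - 1) * b' = (a' - 1) * b.
    apply: (mulfI p0); apply/subr0_eq.
    transitivity (b' * ((a - 1) * p + b * q) - b * ((a' - 1) * p + b' * q)); first by ring.
    by rewrite f1 f1' !mulr0 subrr.
  split=> //.
    apply: (mulfI p0); apply/subr0_eq.
    transitivity ((a' - 1) * (c * p - (a - 1) * q) - (a - 1) * (c' * p - (a' - 1) * q)); first by ring.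
    by rewrite f2 f2' !mulr0 subrr.
  apply: (mulfI p0); apply/subr0_eq.
  transitivity (b * (c' * p - (a' - 1) * q) - b' * (c * p - (a - 1) * q)
     - q * ((a - 1) * b' - (a' - 1) * b)); first by ring.
  by rewrite f2 f2' D1 !mulr0 !subrr mulr0 subrr.
congr mx2.
- by rewrite D3; ring.
- apply/subr0_eq; transitivity (((a - 1) * b' - (a' - 1) * b) * 2); first by ring.
  by rewrite D1 subrr mul0r.
- apply/subr0_eq; transitivity ((c * (a' - 1) - c' * (a - 1)) * 2); first by ring.
  by rewrite D2 subrr mul0r.
- by rewrite (mulrC c) (mulrC c') D3; ring.
Qed.

End Parabolic.

(** * Stabilizers of points at infinity *)

Section Projective.
Variable R : realType.
Local Notation C := R[i].
Implicit Types (D F : set (PSL2 R)) (x y : PSL2 R) (A B X Y : SL2 R).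

Lemma PSL2_ind (P : PSL2 R -> Prop) : (forall A, P (toPSL2 A)) -> forall x, P x.
Proof. by move=> H x; rewrite -(toPSL2K x). Qed.

Lemma toPSL2_mul A B : (toPSL2 A * toPSL2 B)%g = toPSL2 (A * B)%g.
Proof. exact: toPSL2M. Qed.

Lemma toPSL2_inv A : ((toPSL2 A)^-1)%g = toPSL2 A^-1%g.
Proof. exact: toPSL2V. Qed.

Lemma toPSL2_exp A n : (toPSL2 A ^+ n)%g = toPSL2 (A ^+ n)%g.
Proof.
elim: n => [|n IH]; first by rewrite !expg0.
by rewrite !expgS IH toPSL2_mul.
Qed.

Lemma toPSL2_eq A B : toPSL2 A = toPSL2 B -> val A = val B \/ val A = - val B.
Proof. by move=> /toPSL2_eqP/orP[]/eqP; [left|right]. Qed.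

Lemma SL2_valM A B : val (A * B)%g = val A *m val B. Proof. by []. Qed.
Lemma SL2_valV A : val (A^-1)%g = invmx (val A). Proof. by []. Qed.

Lemma toPSL2_ldiv A B : ((toPSL2 A)^-1 * toPSL2 B)%g = toPSL2 (A^-1 * B)%g.
Proof. by rewrite toPSL2_inv toPSL2_mul. Qed.

(** A line of C^2 is a point of the sphere at infinity. Being an eigenvector does not see the sign
    of the lift, so the choice of [repr] is harmless. *)
Definition line_stabilizer (v : 'cV[C]_2) : set (PSL2 R) :=
  [set x | eigenvector (val (repr x)) v].

Lemma line_stabilizerE A v :
  line_stabilizer v (toPSL2 A) <-> eigenvector (val A) v.
Proof.
rewrite /line_stabilizer /=; have [->//|->] := toPSL2_eq (toPSL2K (toPSL2 A)).
by split=> /eigenvectorN; rewrite ?opprK.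
Qed.

Lemma line_stabilizer_subgroup v : v != 0 -> is_subgroup (line_stabilizer v).
Proof.
move=> v0; split.
- by apply/(line_stabilizerE 1%g); exists 1; rewrite mul1mx scale1r.
- elim/PSL2_ind=> A; elim/PSL2_ind=> B; rewrite toPSL2_mul !line_stabilizerE.
  exact: eigenvectorM.
- elim/PSL2_ind=> A; rewrite toPSL2_inv !line_stabilizerE.
  by apply: eigenvectorV => //; apply: SL2_unit.
Qed.

Lemma line_stabilizer_abelian v w : v != 0 -> ~ (exists c, w = c *: v) ->
  abelian_set (line_stabilizer v `&` line_stabilizer w).
Proof.
move=> v0 nw; elim/PSL2_ind=> A; elim/PSL2_ind=> B [].
rewrite !line_stabilizerE => -[a Av] [b Aw] [] /line_stabilizerE[c Bv] /line_stabilizerE[d Bw].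
rewrite !toPSL2_mul; congr toPSL2; apply: val_inj; rewrite !SL2_valM.
apply/subr0_eq; apply: (mx2_eq0 v0 nw); rewrite mulmxBl -!mulmxA.
  by rewrite Av Bv -!scalemxAr Av Bv !scalerA mulrC subrr.
by rewrite Aw Bw -!scalemxAr Aw Bw !scalerA mulrC subrr.
Qed.

Definition virtually_abelian D :=
  exists2 K, finite_index_subgroup K D & abelian_set K.

(* The line of v has a finite orbit under D; if this contained a second line,
   the stabilizer in D of both lines would be abelian of finite index. *)
Lemma finite_index_stabilizer D F v : is_subgroup D -> v != 0 ->
  finite_index_subgroup F D -> F `<=` line_stabilizer v ->
  ~ virtually_abelian D -> D `<=` line_stabilizer v.
Proof.
move=> sD v0 FD Fv nD; apply: contrapT => /existsNP[g /not_implyP[Dg]].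
elim/PSL2_ind: g Dg => g Dg; rewrite line_stabilizerE => gv.
pose w := val g *m v.
have ug := SL2_unit g.
have nw : ~ (exists c, w = c *: v) by [].
have w0 : w != 0.
  by apply: contraNneq v0 => w0; rewrite -(mulKmx ug v) -/w w0 mulmx0.
have [D1 DM DV] := sD; have [n [f Hf]] := finite_index_ord FD.
have sv := line_stabilizer_subgroup v0; have sw := line_stabilizer_subgroup w0.
apply: nD; exists (D `&` (line_stabilizer v `&` line_stabilizer w)); last first.
  by move=> x y [_ Hx] [_ Hy]; apply: (line_stabilizer_abelian v0 nw).
apply: (@finite_index_of_inv _ _ _ _ (fun x => (f x, f (x * toPSL2 g)%g))).
- case: sv sw => [a1 a2 a3] [b1 b2 b3]; split; first by split.
    move=> x y [Dx [Hx1 Hx2]] [Dy [Hy1 Hy2]]; split; first exact: DM.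
    by split; [exact: a2|exact: b2].
  by move=> x [Dx [Hx1 Hx2]]; split; [exact: DV|split; [exact: a3|exact: b3]].
- by move=> x [].
- move=> x y Dx Dy [e1 e2]; split; first exact: subgroup_div.
  split; first by apply: Fv; apply: Hf.
  have /Fv := Hf _ _ (DM _ _ Dx Dg) (DM _ _ Dy Dg) e2.
  elim/PSL2_ind: x {Dx e1 e2} => x; elim/PSL2_ind: y {Dy} => y.
  rewrite (toPSL2_mul x g) (toPSL2_mul y g) !toPSL2_ldiv !line_stabilizerE => -[c e].
  exists c; move: e; rewrite invgM !SL2_valM !SL2_valV !mulmxA => e.
  by rewrite /w scalemxAr -e !mulmxA mulmxV // mul1mx.
Qed.

Definition lifts D : set 'M[C]_2 := [set val A | A in [set A | D (toPSL2 A)]].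

(** Lifts of a subgroup of finite index span all matrices, stated as nondegeneracy for the trace
    form. By [burnside2] a failure gives a line fixed by F, hence by D. *)
Lemma lifts_irreducible D F (T : 'M[C]_2) : is_subgroup D ->
  finite_index_subgroup F D -> ~ virtually_abelian D ->
  (forall v, v != 0 -> ~ D `<=` line_stabilizer v) ->
  (forall X : 'M[C]_2, lifts F X -> \tr (T *m X) = 0) -> T = 0.
Proof.
move=> sD FD nD irr HT; apply: contrapT => /eqP T0.
have [[F1 FM FV] _ _] := FD.
have [||v [v0 Hv]] := @burnside2 _ (lifts F) T _ _ T0 HT.
- by exists 1%g.
- move=> _ _ [A FA <-] [B FB <-]; exists (A * B)%g => //=.
  by rewrite -toPSL2_mul; apply: FM.
apply: (irr v v0); apply: (finite_index_stabilizer sD v0 FD) => //.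
by elim/PSL2_ind=> A FA; apply/line_stabilizerE; apply: Hv; exists A.
Qed.

(** Half-turns have eigenvalue i or -i on v, so the squared eigenvalue is a sign on the generated
    group. Elements of sign 1 have a lift that fixes v, and such lifts commute. *)
Lemma half_turns_fixing_line (S : set (PSL2 R)) v : v != 0 ->
  (forall x, S x -> exists A, [/\ toPSL2 A = x, \tr (val A) = 0 & eigenvector (val A) v]) ->
  virtually_abelian (generated S).
Proof.
move=> v0 HS.
(* Only the square of the eigenvalue is independent of the lift. *)
pose P (e : C) := [set x | exists A, toPSL2 A = x /\ exists c, c ^+ 2 = e /\ val A *m v = c *: v].
have P1 x y e : P e x -> P e y -> e != 0 -> P 1 (x^-1 * y)%g.
  move=> [A [<- [c [c2 Ac]]]] [B [<- [d [d2 Bd]]]] e0.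
  exists (A^-1 * B)%g; rewrite toPSL2_ldiv; split=> //.
  have c0 : c != 0 by apply: contraNneq e0 => c0; rewrite -c2 c0 expr0n.
  exists (c^-1 * d); rewrite exprMn exprVn c2 d2 mulVf //; split=> //.
  have Vc : invmx (val A) *m v = c^-1 *: v.
    by rewrite -{1}(scalerK c0 v) -Ac -scalemxAr mulKmx // SL2_unit.
  by rewrite SL2_valM SL2_valV -mulmxA Bd -scalemxAr Vc scalerA mulrC.
have SP : generated S `<=` P 1 `|` P (-1).
  apply: generated_sub; last first.
    move=> x /HS[A [<- tA [c Ac]]]; right; exists A; split=> //; exists c; split=> //.
    have /(congr1 (mulmx^~ v)) := mx2_sqr tA (SL2_det A).
    rewrite -mulmxA Ac -scalemxAr Ac mulNmx mul1mx scalerA => /eqP.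
    rewrite -addr_eq0 -[X in _ + X]scale1r -scalerDl scaler_eq0 (negPf v0) orbF.
    by rewrite addr_eq0 -expr2 => /eqP.
  have PM x y e f : P e x -> P f y -> P (e * f) (x * y)%g.
    move=> [A [<- [c [c2 Ac]]]] [B [<- [d [d2 Bd]]]].
    exists (A * B)%g; rewrite toPSL2_mul; split=> //; exists (c * d).
    split; first by rewrite exprMn c2 d2.
    by rewrite SL2_valM -mulmxA Bd -scalemxAr Ac scalerA mulrC.
  have PV x e : P e x -> e != 0 -> P e^-1 (x^-1)%g.
    move=> [A [<- [c [c2 Ac]]]] e0; exists (A^-1)%g; rewrite toPSL2_inv; split=> //.
    have c0 : c != 0 by apply: contraNneq e0 => c0; rewrite -c2 c0 expr0n.
    exists c^-1; rewrite exprVn c2; split=> //.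
    by rewrite SL2_valV -{1}(scalerK c0 v) -Ac -scalemxAr mulKmx // SL2_unit.
  split.
  - by left; exists 1%g; split=> //; exists 1; rewrite expr1n mul1mx scale1r.
  - move=> x y [] Px [] Py; have := PM _ _ _ _ Px Py; rewrite ?mulr1 ?mulrNN ?mul1r;
      by [left|right].
  - by move=> x [] /PV; rewrite ?oppr_eq0 oner_eq0 ?invrN1 ?invr1 => /(_ isT); [left|right].
pose K := generated S `&` P 1.
have sS := generated_subgroup S; have [S1 SM SV] := sS.
exists K.
  apply: (@finite_index_of_inv _ _ _ _ (fun x => asbool (P 1 x))).
  + split.
    * by split=> //; exists 1%g; split=> //; exists 1; rewrite expr1n mul1mx scale1r.
    * move=> x y [Sx Px] [Sy Py]; split; first exact: (SM _ _ Sx Sy).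
      move: Px Py => [A [<- [c [c2 Ac]]]] [B [<- [d [d2 Bd]]]].
      exists (A * B)%g; rewrite toPSL2_mul; split=> //; exists (c * d).
      split; first by rewrite exprMn c2 d2 mulr1.
      by rewrite SL2_valM -mulmxA Bd -scalemxAr Ac scalerA mulrC.
    * move=> x [Sx Px]; split; first exact: (SV _ Sx).
      rewrite -[(x^-1)%g]mulg1; apply: (P1 _ _ 1); rewrite ?oner_eq0 //.
      by exists 1%g; split=> //; exists 1; rewrite expr1n mul1mx scale1r.
  + by move=> x [].
  + move=> x y Sx Sy e; split; first exact: (subgroup_div sS Sx Sy).
    have [Px|nPx] := pselect (P 1 x).
      apply: (P1 _ _ 1); rewrite ?oner_eq0 //.
      by apply/asboolP; rewrite -e; apply/asboolP.
    have nPy : ~ P 1 y by move=> /asboolP; rewrite -e => /asboolP.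
    by apply: (P1 _ _ (-1)); rewrite ?oppr_eq0 ?oner_eq0 //;
       [have [] := SP _ Sx|have [] := SP _ Sy].
have fixv x : P 1 x -> exists2 A, toPSL2 A = x & val A *m v = v.
  move=> [A [<- [c [/eqP]]]]; rewrite sqrf_eq1 => /orP[]/eqP->.
    by rewrite scale1r; exists A.
  rewrite scaleN1r => Av.
  have dN : \det (- val A) == 1.
    by rewrite -scaleN1r detZ SL2_det mulr1 expr2 mulrNN mulr1.
  exists (Sub (- val A) dN); last by rewrite SubK mulNmx Av opprK.
  by apply/toPSL2_eqP; rewrite /eq_up_to_sign SubK eqxx orbT.
move=> x y [_ /fixv[A <- Av]] [_ /fixv[B <- Bv]].
rewrite !toPSL2_mul; congr toPSL2; apply: val_inj; rewrite !SL2_valM.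
by apply: (unipotent_comm v0); rewrite ?SL2_det.
Qed.

End Projective.

(** * Half-turns and complex distances *)

Section Lines.
Variable R : realType.
Local Notation C := R[i].
Implicit Types (A B G : SL2 R) (M : 'M[C]_2) (m : oriented_line R) (z : option C).

Lemma SL2_opp A : exists2 B, toPSL2 B = toPSL2 A & val B = - val A.
Proof.
have dN : \det (- val A) == 1.
  by rewrite -scaleN1r detZ SL2_det mulr1 expr2 mulrNN mulr1.
by exists (Sub (- val A) dN); rewrite ?SubK //; apply/toPSL2_eqP;
  rewrite /eq_up_to_sign SubK eqxx orbT.
Qed.

(** Homogeneous coordinates, in which [moebius] is the matrix action up to a nonzero scalar. *)
Definition hvec z : 'cV[C]_2 := if z is Some w then cv2 w 1 else cv2 1 0.

Lemma hvec_neq0 z : hvec z != 0.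
Proof.
by case: z => [w|]; rewrite cv2_0; apply/eqP => /cv2_inj[/eqP + /eqP]; rewrite oner_eq0.
Qed.

Lemma hvec_inj c z z' : hvec z = c *: hvec z' -> z = z'.
Proof.
case: z z' => [w|] [w'|] //=; rewrite cv2_scale => /cv2_inj[].
- by rewrite mulr1 => -> <-; rewrite mul1r.
- by rewrite mulr0 => _ /eqP; rewrite oner_eq0.
- by rewrite mulr1 => + c0; rewrite -c0 mul0r => /eqP; rewrite oner_eq0.
Qed.

Lemma moebius_hvec A z :
  exists2 c, c != 0 & val A *m hvec z = c *: hvec (moebius (val A) z).
Proof.
move: (SL2_det A); elim/mx2_ind: (val A) => a b c d; rewrite !mx2_simpl => D.
case: z => [w|]; rewrite /moebius !mxE /= !mx2_simpl.
  have [e|ne] := eqVneq (c * w + d) 0; last first.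
    by exists (c * w + d); rewrite //= cv2_scale !mulr1 [(c * w + d) * _]mulrC divfK.
  exists (a * w + b); last by rewrite /= cv2_scale !mulr1 mulr0 e.
  apply/eqP => f; have /eqP := oner_neq0 C; apply.
  transitivity (a * (c * w + d) - c * (a * w + b)); first by rewrite -D; ring.
  by rewrite e f !mulr0 subrr.
have [e|ne] := eqVneq c 0; last first.
  by exists c; rewrite //= cv2_scale !mulr1 !mulr0 !addr0 [c * _]mulrC divfK.
exists a; last by rewrite /= cv2_scale !mulr1 !mulr0 !addr0 e.
by apply/eqP => f; have /eqP := oner_neq0 C; apply; rewrite -D e f mul0r mulr0 subrr.
Qed.

Lemma act_hvec A z z' : act (toPSL2 A) z = z' ->
  exists2 c, c != 0 & val A *m hvec z = c *: hvec z'.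
Proof. by rewrite act_toPSL2 => <-; exact: moebius_hvec. Qed.

(* The half-turn matrix of an oriented line in the sense of the complex
   distance formula: the sign of the lift encodes the orientation. *)
Definition line_mx m M :=
  M *m hvec (init m) = 'i *: hvec (init m) /\
  M *m hvec (term m) = - 'i *: hvec (term m).

Lemma eigenvector_conj G M (u w : 'cV[C]_2) a c : c != 0 ->
  val G *m u = c *: w -> M *m u = a *: u ->
  (val G *m M *m invmx (val G)) *m w = a *: w.
Proof.
move=> c0 Gu Mu; apply: (scalerI c0); rewrite scalemxAr -Gu -!mulmxA mulKmx ?SL2_unit //.
by rewrite Mu -scalemxAr Gu scalerA mulrC -scalerA.
Qed.

Lemma mx2_eq_on M M' z z' : z != z' ->
  M *m hvec z = M' *m hvec z -> M *m hvec z' = M' *m hvec z' -> M = M'.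
Proof.
move=> zz e e'; apply/subr0_eq; apply: (mx2_eq0 (hvec_neq0 z) (w := hvec z')).
- by move=> [c /hvec_inj/esym/eqP]; rewrite (negPf zz).
- by rewrite mulmxBl e subrr.
- by rewrite mulmxBl e' subrr.
Qed.

(** A squares to -1 on two independent vectors, so Cayley-Hamilton leaves (tr A) A = 0. *)
Lemma line_mx_trace m A : line_mx m (val A) -> \tr (val A) = 0.
Proof.
move=> [e f]; have ii : 'i * 'i = -1 :> C by rewrite -expr2 sqrCi.
have sq : val A *m val A = - 1%:M.
  apply: (mx2_eq_on (init_neq_term m)); rewrite -mulmxA ?e ?f -!scalemxAr ?e ?f.
    by rewrite mulNmx mul1mx scalerA ii scaleN1r.
  by rewrite mulNmx mul1mx scalerA mulrNN ii scaleN1r.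
have /eqP := mx2_cayley (val A); rewrite sq SL2_det -subr_eq subrr eq_sym scaler_eq0.
case/orP=> [/eqP //|/eqP A0]; have := SL2_det A.
by rewrite A0 det0 => /eqP; rewrite eq_sym oner_eq0.
Qed.

(** With the axis moved to the line from 0 to oo the lift is diagonal with entries -s, s and s^2 =
    -1; the choice of lift arranges s = i. *)
Lemma half_turn_lift g m : half_turn g m ->
  exists2 A, toPSL2 A = g & line_mx m (val A).
Proof.
case=> h; elim/PSL2_ind: h => H; elim/PSL2_ind: g => g [Hi Ht] Hz.
have uH := SL2_unit H.
have [c c0 {Hi}Hi] := act_hvec Hi; have [d d0 {Ht}Ht] := act_hvec Ht.
have {Hz} [K [eg Hz dK]] : exists K : 'M[C]_2,
    [/\ val g = invmx (val H) *m K *m val H,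
        forall w, moebius K (Some w) = Some (- w) & \det K = 1].
  exists (val (H * g * H^-1)%g); split; last exact: SL2_det.
    by rewrite !SL2_valM SL2_valV !mulmxA mulVmx // mul1mx mulmxKV.
  move=> w; rewrite -Hz -act_toPSL2.
  by rewrite (toPSL2_inv H) (toPSL2_mul H g) (toPSL2_mul (H * g)%g).
have [s ss Ks] : exists2 s, s ^+ 2 = - 1 & K = mx2 (- s) 0 0 s.
  move: Hz dK; elim/mx2_ind: K {eg} => p q r s Hz; rewrite mx2_det => D.
  (* If r were nonzero, -s / r would be sent to oo. The values at 0 and 1 then give q = 0 and p =
     -s. *)
  have := Hz 0; have Hz1 := Hz 1; have := Hz (- (s / r)).
  move: Hz1; rewrite /moebius !mxE /=.
  have [r0|r0] := eqVneq r 0; last first.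
    by have -> : r * - (s / r) + s = 0 by [field]; rewrite eqxx.
  rewrite r0 !mul0r !add0r; have [//|s0] := eqVneq s 0.
  move=> [e1] _; rewrite !mulr0 add0r => -[/eqP]; rewrite oppr0 mulf_eq0 invr_eq0 (negPf s0) orbF.
  move=> /eqP q0; move: e1; rewrite q0 mulr1 addr0 => /(canRL (divfK s0)); rewrite mulN1r => ps.
  exists s; last by rewrite ps.
  by move: D; rewrite q0 ps mul0r subr0 mulNr -expr2 => /(congr1 -%R); rewrite opprK.
have act_s w u a b : b != 0 -> val H *m hvec w = b *: u -> K *m u = a *: u ->
    val g *m hvec w = a *: hvec w.
  move=> b0 Hw Ku; rewrite eg -!mulmxA Hw -scalemxAr Ku scalerA mulrC -scalerA -Hw.
  by rewrite -scalemxAr mulKmx.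
have gi : val g *m hvec (init m) = s *: hvec (init m).
  by apply: (act_s _ _ _ _ c0 Hi); rewrite Ks !mx2_simpl; congr cv2; ring.
have gt : val g *m hvec (term m) = - s *: hvec (term m).
  by apply: (act_s _ _ _ _ d0 Ht); rewrite Ks !mx2_simpl; congr cv2; ring.
have : s == 'i \/ s == - 'i by apply/orP; rewrite -eqf_sqr ss sqrCi.
case=> /eqP es; first by exists g => //; rewrite es in gi gt.
have [B eB vB] := SL2_opp g; exists B => //; rewrite /line_mx vB !mulNmx gi gt es.
by rewrite !scaleNr !opprK.
Qed.

(** The product has determinant 1 and an eigenvalue equal to its own inverse, which is therefore
    double. *)
Lemma trace_shared_eigenvector A B (u : 'cV[C]_2) a b : u != 0 -> (a * b) ^+ 2 = 1 ->
  val A *m u = a *: u -> val B *m u = b *: u ->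
  \tr (val A *m val B) = (a * b) *+ 2.
Proof.
move=> u0 ab2 Au Bu.
have Nu : val (A * B)%g *m u = (a * b) *: u.
  by rewrite SL2_valM -mulmxA Bu -scalemxAr Au scalerA mulrC.
have := congr1 (mulmx^~ u) (mx2_cayley (val (A * B)%g)).
rewrite SL2_det -mulmxA Nu -scalemxAr Nu scalerA -expr2 ab2 scale1r mulmxBl.
rewrite -scalemxAl Nu scalerA mul1mx => /eqP; rewrite eq_sym subr_eq -{2 3}[u]scale1r -scalerDl.
rewrite -subr_eq0 -scalerBl scaler_eq0 (negPf u0) orbF subr_eq0 => /eqP.
move: ab2 => /eqP; rewrite sqrf_eq1 => /orP[]/eqP->; first by rewrite mulr1 => ->.
by rewrite mulrN1 => /(congr1 -%R); rewrite opprK SL2_valM => ->; rewrite mulr2n opprD.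
Qed.

(** In normal position both matrices are antidiagonal and the trace is read off; lines with a common
    endpoint have a common eigenvector instead. *)
Lemma complex_distance_trace m1 m2 (mu : C) A B :
  line_mx m1 (val A) -> line_mx m2 (val B) -> complex_distance m1 m2 mu ->
  \tr (val A *m val B) = - (cexp mu + (cexp mu)^-1).
Proof.
move=> [Ai At] [Bi Bt] [_ _ Hmu].
have ii : 'i * 'i = -1 :> C by rewrite -expr2 sqrCi.
have N1 : (-1) ^+ 2 = 1 :> C by rewrite sqrrN expr1n.
case: Hmu => [[g]||].
- elim/PSL2_ind: g => G [g1i g1t] [g2i g2t]; set w := cexp mu in g2i g2t *.
  (* Otherwise both endpoints of [m2] would be sent to 0. *)
  have w0 : w != 0.
    apply/eqP => w0; move: g2i g2t; rewrite w0 oppr0 => /act_hvec[c c0 e] /act_hvec[d d0 f].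
    have uG := SL2_unit G.
    have : hvec (init m2) = (c / d) *: hvec (term m2).
      by rewrite -(mulKmx uG (hvec (init m2))) e -(mulKmx uG (hvec (term m2))) f
        -!scalemxAr scalerA divfK.
    by move=> /hvec_inj/eqP; rewrite (negPf (init_neq_term m2)).
  move: g1i g1t g2i g2t => /act_hvec[c1 c10 e1] /act_hvec[d1 d10 f1] /act_hvec[c2 c20 e2] /act_hvec[d2 d20 f2].
  have {c10 e1 Ai}A1 := eigenvector_conj c10 e1 Ai.
  have {d10 f1 At}A2 := eigenvector_conj d10 f1 At.
  have {c20 e2 Bi}B1 := eigenvector_conj c20 e2 Bi.
  have {d20 f2 Bt}B2 := eigenvector_conj d20 f2 Bt.
  have N1' : - 1 != 1 :> C.
    by rewrite -subr_eq0 -opprD oppr_eq0 -mulr2n pnatr_eq0.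
  have eA : val G *m val A *m invmx (val G) = mx2 0 (- 'i) (- 'i) 0.
    apply: (@mx2_eq_on _ _ (Some (-1)) (Some 1)); rewrite ?A1 ?A2.
    + by apply: contra_neq N1' => /Some_inj.
    + by rewrite /= !mx2_simpl; congr cv2; ring.
    + by rewrite /= !mx2_simpl; congr cv2; ring.
  have eB : val G *m val B *m invmx (val G) = mx2 0 (- 'i * w) (- 'i / w) 0.
    apply: (@mx2_eq_on _ _ (Some (- w)) (Some w)); rewrite ?B1 ?B2.
    + apply/eqP => /Some_inj/eqP; rewrite -subr_eq0 -opprD oppr_eq0 -mulr2n.
      by rewrite mulrn_eq0 (negPf w0).
    + by rewrite /= !mx2_simpl; congr cv2; field.
    + by rewrite /= !mx2_simpl; congr cv2; field.
  have -> : \tr (val A *m val B) = \tr ((val G *m val A *m invmx (val G)) *m (val G *m val B *m invmx (val G))).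
    rewrite -!mulmxA mulKmx ?SL2_unit // [RHS]mxtrace_mulC -!mulmxA.
    by rewrite mulVmx ?SL2_unit // mulmx1.
  rewrite eA eB !mx2_simpl.
  transitivity (('i * 'i) * (w + w^-1)); first by field.
  by rewrite ii mulN1r.
- move=> [-> sh].
  have -> : cexp 0 = 1 :> C by rewrite /cexp /= expR0 cos0 sin0 mulr1 mulr0.
  rewrite invr1; case: sh => e.
    rewrite -e in Bi.
    by rewrite (trace_shared_eigenvector (hvec_neq0 _) _ Ai Bi) ii ?N1 // mulr2n opprD.
  rewrite -e in Bt.
  by rewrite (trace_shared_eigenvector (hvec_neq0 _) _ At Bt) mulrNN ii ?N1 // mulr2n opprD.
- move=> [-> sh].
  have -> : cexp (0 +i* pi)%C = - 1 :> C.
    by rewrite /cexp /= expR0 cospi sinpi mul1r mulr0; apply/eqP; rewrite eq_complex /= oppr0 !eqxx.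
  rewrite invrN1; case: sh => e.
    rewrite -e in Bt.
    by rewrite (trace_shared_eigenvector (hvec_neq0 _) _ Ai Bt) mulrN ii opprK ?expr1n // -opprD opprK.
  rewrite -e in Bi.
  by rewrite (trace_shared_eigenvector (hvec_neq0 _) _ At Bi) mulNr ii opprK ?expr1n // -opprD opprK.
Qed.

Lemma regular_triangle_group_lifts (D : set (PSL2 R)) : regular_triangle_group D ->
  exists (A B M : SL2 R) (t : C),
    [/\ D = generated [set toPSL2 A; toPSL2 B; toPSL2 M],
        [/\ \tr (val A) = 0, \tr (val B) = 0 & \tr (val M) = 0] &
        [/\ \tr (val A *m val B) = - t, \tr (val A *m val M) = - t &
            \tr (val M *m val B) = - t]].
Proof.
case=> a [b [c [ma [mb [mc [mu [-> [ha hb hc] [dab dac dcb]]]]]]]].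
have [A <- lA] := half_turn_lift ha; have [B <- lB] := half_turn_lift hb.
have [M <- lM] := half_turn_lift hc.
exists A, B, M, (cexp mu + (cexp mu)^-1); split=> //.
  by split; [exact: line_mx_trace lA|exact: line_mx_trace lB|exact: line_mx_trace lM].
by split; [exact: complex_distance_trace lA lB dab|exact: complex_distance_trace lA lM dac
  |exact: complex_distance_trace lM lB dcb].
Qed.

End Lines.

(** * Triples with a given trace *)

Section Conjugacy.
Variable G : groupType.
Implicit Types (D S : set G) (g : G).
Local Open Scope group_scope.

Lemma conjugacy_class_conj D g :
  conjugacy_class [set x ^ g | x in D] = conjugacy_class D.
Proof.
apply/seteqP; split=> _ [h _ <-].
  exists (g * h) => //; apply/seteqP; split=> y /=.
    by move=> [x Dx <-]; exists (x ^ g); [exists x|rewrite conjgM].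
  by move=> [_ [x Dx <-] <-]; exists x; rewrite ?conjgM.
exists (g^-1 * h) => //; apply/seteqP; split=> y /=.
  by move=> [_ [x Dx <-] <-]; exists x; rewrite // conjgM conjgK.
by move=> [x Dx <-]; exists (x ^ g); [exists x|rewrite conjgM conjgK].
Qed.

Lemma conj_generated S g :
  [set x ^ g | x in generated S] = generated [set x ^ g | x in S].
Proof.
have sub T h : [set x ^ h | x in generated T] `<=` generated [set x ^ h | x in T].
  have [g1 gM gV] := generated_subgroup [set x ^ h | x in T].
  suff H : generated T `<=` [set x | generated [set x ^ h | x in T] (x ^ h)].
    by move=> _ [x /H Hx <-].
  apply: generated_sub; last by move=> x Tx; apply: sub_generated; exists x.
  split=> [|x y Hx Hy|x Hx] /=.
  - by rewrite conj1g.
  - by rewrite conjMg; apply: gM.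
  - by rewrite conjVg; apply: gV.
apply/seteqP; split; first exact: sub.
move=> y Hy; exists (y ^ g^-1); last by rewrite conjgKV.
have : [set x ^ g^-1 | x in generated [set x ^ g | x in S]] (y ^ g^-1) by exists y.
move/sub; apply: generated_sub; first exact: generated_subgroup.
by move=> _ [_ [x Sx <-] <-]; rewrite conjgK; apply: sub_generated.
Qed.

End Conjugacy.

Section NormalForm.
Variable R : realType.
Local Notation C := R[i].
Implicit Types (A B M P : 'M[C]_2) (s t eta : C).

Definition std_i : 'M[C]_2 := mx2 'i 0 0 (- 'i).
Definition std_j : 'M[C]_2 := mx2 0 (- 1) 1 0.
(** This is s/2 [std_i] + t/2 [std_j] + (i eta)/2 [std_i] [std_j], written out. *)
Definition std_half s t eta : 'M[C]_2 :=
  mx2 (s * 'i / 2) ((eta - t) / 2) ((eta + t) / 2) (- (s * 'i / 2)).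

(** Equal determinants of A and A - s [std_i] fix the diagonal, the trace against [std_j] fixes c -
    b, and det A = 1 then fixes (b + c)^2; only the sign of eta = b + c stays open. *)
Lemma std_half_unique A B s t : s != 0 -> s ^+ 2 = 2 - t ->
  [/\ \tr A = 0, \det A = 1 & \det B = 1] -> \tr (A *m std_j) = - t ->
  A - B = s *: std_i ->
  exists2 eta, eta ^+ 2 = t ^+ 2 - t - 2 &
    A = std_half s t eta /\ B = std_half (- s) t eta.
Proof.
move=> s0 s2 [tA dA dB] tAj AB.
have {AB} eB : B = A - s *: std_i by rewrite -AB opprB addrC subrK.
have ii : 'i ^+ 2 = -1 :> C by rewrite sqrCi.
subst B; move: tA dA dB tAj; elim/mx2_ind: A => a b c d.
rewrite /std_i /std_j !mx2_simpl !mulr0 !mulr1 !mulrN1 !subr0 add0r addr0 => ad.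
have {ad} -> : d = - a by apply/eqP; rewrite -addr_eq0 addrC ad.
move=> dA dB tj.
have ea : a = s * 'i / 2.
  have : (s * 'i) * (a * 2 - s * 'i) = 0.
    apply/eqP; rewrite -oppr_eq0; apply/eqP.
    transitivity ((a * - a - b * c) - ((a - s * 'i) * (- a - s * - 'i) - b * c)); first by ring.
    by rewrite dA dB subrr.
  move/eqP; rewrite mulf_eq0 mulf_eq0 (negPf s0) (negPf (neq0Ci C)) /= subr_eq0 => /eqP <-.
  by rewrite mulfK // pnatr_eq0.
have n2 : 2 != 0 :> C by rewrite pnatr_eq0.
have ebc : b * c * 4 = - 2 - t.
  have : a ^+ 2 * 4 = t - 2.
    rewrite ea; transitivity (s ^+ 2 * 'i ^+ 2); first by field.
    by rewrite s2 ii; ring.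
  by move=> e; transitivity (- a ^+ 2 * 4 - (a * - a - b * c) * 4); [ring|rewrite dA mulNr e; ring].
have ec : c = b + t by rewrite -[t]opprK -tj; ring.
exists (b + c).
  transitivity ((b - c) ^+ 2 + b * c * 4); first by ring.
  by rewrite tj ebc; ring.
rewrite /std_half; split; rewrite ea ec; by congr mx2; field.
Qed.

Lemma mx2_columns X (u w : 'cV[C]_2) a b c d :
  X *m u = a *: u + c *: w -> X *m w = b *: u + d *: w ->
  X *m mx2 (u 0 0) (w 0 0) (u 1 0) (w 1 0) =
  mx2 (u 0 0) (w 0 0) (u 1 0) (w 1 0) *m mx2 a b c d.
Proof.
elim/mx2_ind: X => x y z t; elim/cv2_ind: u => p q; elim/cv2_ind: w => p' q'.
rewrite !mx2_simpl !mxE /= => /cv2_inj[e1 e2] /cv2_inj[e3 e4].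
by congr mx2; rewrite ?e1 ?e2 ?e3 ?e4; ring.
Qed.

Lemma det_columns0 (u w : 'cV[C]_2) : u != 0 ->
  u 0 0 * w 1 0 - w 0 0 * u 1 0 = 0 -> exists c, w = c *: u.
Proof.
elim/cv2_ind: u => p q; elim/cv2_ind: w => p' q'; rewrite !mxE /= => u0 /subr0_eq e.
have [p0|p0] := eqVneq p 0.
  have q0 : q != 0 by apply: contraNneq u0 => q0; rewrite p0 q0 -cv2_0.
  exists (q' / q); rewrite cv2_scale divfK // p0 mulr0; congr cv2.
  by apply: (mulIf q0); rewrite -e p0 !mul0r.
exists (p' / p); rewrite cv2_scale divfK //; congr cv2.
by apply: (mulfI p0); rewrite e; field.
Qed.

(** The new basis is an i-eigenvector v of E followed by M v; the base change is rescaled to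
    determinant 1. *)
Lemma quaternion_basis_std (E M : 'M[C]_2) : \tr E = 0 ->
  E *m E = - 1%:M -> M *m M = - 1%:M -> E *m M = - (M *m E) ->
  exists2 G : SL2 R, invmx (val G) *m E *m val G = std_i &
    invmx (val G) *m M *m val G = std_j.
Proof.
move=> tE EE MM EM.
have ii : 'i * 'i = -1 :> C by rewrite -expr2 sqrCi.
have i2 : 'i + 'i != 0 :> C by rewrite -mulr2n mulrn_eq0 negb_or neq0Ci.
have n0 : E + 'i%:M != 0.
  apply/eqP => /(congr1 mxtrace); rewrite linearD /= tE mxtrace_scalar linear0 add0r.
  by rewrite mulr2n; apply/eqP.
have /matrix0Pn[k [j nij]] := n0.
(* Since E (E + i) = i (E + i), nonzero columns of E + i are i-eigenvectors. *)
have [v ev] : exists v, v = col j (E + 'i%:M) by exists (col j (E + 'i%:M)).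
have v0 : v != 0 by apply: contraNneq nij => v0; move: ev; rewrite v0 => /colP/(_ k); rewrite !mxE => <-.
have Ev : E *m v = 'i *: v.
  rewrite ev colE mulmxA mulmxDr EE scalemxAl; congr (_ *m _).
  by rewrite scalerDr mul_mx_scalar addrC scale_scalar_mx ii raddfN.
have [w Mv] : exists w, M *m v = w by exists (M *m v).
have Mw : M *m w = - v by rewrite -Mv mulmxA MM mulNmx mul1mx.
have Ew : E *m w = - 'i *: w by rewrite -Mv mulmxA EM mulNmx -mulmxA Ev -scalemxAr scaleNr.
have w0 : w != 0 by apply: contraNneq v0 => w0; rewrite -oppr_eq0 -Mw w0 mulmx0.
pose P := mx2 (v 0 0) (w 0 0) (v 1 0) (w 1 0).
have EP : E *m P = P *m std_i.
  by apply: mx2_columns; rewrite ?Ev ?Ew scale0r ?add0r ?addr0.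
have MP : M *m P = P *m std_j.
  by apply: mx2_columns; rewrite ?Mw ?Mv scale0r ?add0r ?addr0 ?scale1r ?scaleN1r.
have dP : \det P != 0.
  apply/eqP; rewrite mx2_det => d0.
  have [c wc] := det_columns0 v0 d0.
  have /eqP : ('i + 'i) *: w = 0.
    rewrite scalerDl; apply/eqP; rewrite addr_eq0 -scaleNr -Ew {2}wc -scalemxAr Ev.
    by rewrite wc scalerA scalerA mulrC.
  by rewrite scaler_eq0 (negPf i2) (negPf w0).
pose r := sqrtC (\det P).
have r0 : r != 0 by rewrite sqrtC_eq0.
have dG : \det (r^-1 *: P) == 1.
  by rewrite detZ exprVn sqrtCK mulVf.
pose G : SL2 R := Sub (r^-1 *: P) dG.
have GV : val G = r^-1 *: P by rewrite SubK.
exists G.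
  by rewrite -mulmxA {2}GV -scalemxAr EP scalemxAl -GV mulKmx // SL2_unit.
by rewrite -mulmxA {2}GV -scalemxAr MP scalemxAl -GV mulKmx // SL2_unit.
Qed.

Definition std_group s t eta : set (PSL2 R) :=
  generated [set toPSL2 X | X in [set X : SL2 R | [\/ val X = std_half s t eta,
    val X = std_half (- s) t eta | val X = std_j]]].

(** E = (A - B) / s squares to -1 because AB + BA = -t, and anticommutes with M because tr AM = tr
    MB. Moving (E, M) to ([std_i], [std_j]) leaves only the sign of eta free in A and B. *)
Lemma regular_triple_std (A B M : SL2 R) s t : s != 0 -> s ^+ 2 = 2 - t ->
  [/\ \tr (val A) = 0, \tr (val B) = 0 & \tr (val M) = 0] ->
  [/\ \tr (val A *m val B) = - t, \tr (val A *m val M) = - t &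
      \tr (val M *m val B) = - t] ->
  exists2 eta, eta ^+ 2 = t ^+ 2 - t - 2 &
    conjugacy_class (generated [set toPSL2 A; toPSL2 B; toPSL2 M]) =
    conjugacy_class (std_group s t eta).
Proof.
move=> s0 s2 [tA tB tM] [AB AM MB].
have A2 := mx2_sqr tA (SL2_det A); have B2 := mx2_sqr tB (SL2_det B).
have M2 := mx2_sqr tM (SL2_det M).
have BA := mx2_anticomm tA tB AB; have MA := mx2_anticomm tA tM AM.
have BM := mx2_anticomm tM tB MB.
pose E := s^-1 *: (val A - val B).
have [||||G EG MG] := @quaternion_basis_std E (val M).
- by rewrite linearZ linearB /= tA tB subrr mulr0.
- rewrite /E -scalemxAl -scalemxAr scalerA -expr2 exprVn s2 mulmxBl !mulmxBr A2 B2 BA.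
  have n0 : 2 - t != 0 by rewrite -s2 expf_eq0.
  apply: (scalerI n0); rewrite scalerA mulfV // scale1r.
  move: (val A *m val B) => U; apply/matrixP => i j; rewrite !mxE.
  by case: (i == j); rewrite ?mulr1n ?mulr0n; ring.
- exact: M2.
- rewrite /E -scalemxAl -scalemxAr -scalerN mulmxBl mulmxBr BM MA.
  congr (_ *: _); move: (val A *m val M) (val M *m val B) => U V.
  by apply/matrixP => i j; rewrite !mxE; ring.
pose cj X := invmx (val G) *m X *m val G.
have uG := SL2_unit G.
have cjM X Y : cj (X *m Y) = cj X *m cj Y.
  by rewrite /cj -!mulmxA; congr (_ *m (_ *m _)); rewrite mulKVmx.
have cjtr X : \tr (cj X) = \tr X by rewrite /cj mxtrace_mulC mulmxA mulmxV // mul1mx.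
have cjdet X : \det (cj X) = \det X.
  by rewrite /cj !det_mulmx mulrAC -det_mulmx mulVmx // det1 mul1r.
have [|||eta eta2 [eA eB]] := @std_half_unique (cj (val A)) (cj (val B)) s t s0 s2.
- by rewrite cjtr !cjdet !SL2_det.
- by rewrite -MG -/(cj (val M)) -cjM cjtr.
- by rewrite -EG /E -scalemxAr -scalemxAl scalerA divff // scale1r mulmxBr mulmxBl.
exists eta => //.
have cjS (X : SL2 R) : (toPSL2 X ^ toPSL2 G)%g = toPSL2 (X ^ G)%g.
  by rewrite /conjg (toPSL2_inv G) (toPSL2_mul X G) (toPSL2_mul G^-1%g).
have vS (X : SL2 R) : val (X ^ G)%g = cj (val X) by rewrite /conjg /cj !SL2_valM SL2_valV mulmxA.
rewrite -(conjugacy_class_conj (generated [set toPSL2 A; toPSL2 B; toPSL2 M]) (toPSL2 G)).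
rewrite conj_generated; congr (conjugacy_class (generated _)).
apply/seteqP; split=> x.
  move=> [_ [[->|->]|->] <-]; rewrite cjS.
  - by exists (A ^ G)%g => //; apply: Or31; rewrite vS.
  - by exists (B ^ G)%g => //; apply: Or32; rewrite vS.
  - by exists (M ^ G)%g => //; apply: Or33; rewrite vS.
have vi (X Y : SL2 R) : val X = cj (val Y) -> toPSL2 X = (toPSL2 Y ^ toPSL2 G)%g.
  by move=> e; rewrite cjS; congr toPSL2; apply: val_inj; rewrite vS.
move=> [X [] eX <-].
- by exists (toPSL2 A); [left; left|rewrite -(vi X) // eA].
- by exists (toPSL2 B); [left; right|rewrite -(vi X) // eB].
- by exists (toPSL2 M); [right|rewrite -(vi X) // eX -MG].
Qed.

Lemma finite_conjugacy_classes t : t != 2 ->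
  finite_set [set conjugacy_class D | D in [set D : set (PSL2 R) |
    exists A B M : SL2 R,
      [/\ D = generated [set toPSL2 A; toPSL2 B; toPSL2 M],
        [/\ \tr (val A) = 0, \tr (val B) = 0 & \tr (val M) = 0] &
        [/\ \tr (val A *m val B) = - t, \tr (val A *m val M) = - t &
            \tr (val M *m val B) = - t]]]].
Proof.
move=> t2; pose s := sqrtC (2 - t); pose e := sqrtC (t ^+ 2 - t - 2).
have s0 : s != 0 by rewrite sqrtC_eq0 subr_eq0 eq_sym.
apply: (@sub_finite_set _ _ [set conjugacy_class (std_group s t e);
   conjugacy_class (std_group s t (- e))]); last first.
  by rewrite finite_setU; split; exact: finite_set1.
move=> _ [D [A [B [M [-> tr0 trt]]]] <-].
have [eta eta2 ->] := regular_triple_std s0 (sqrtCK _) tr0 trt.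
have : (eta == e) || (eta == - e) by rewrite -eqf_sqr eta2 sqrtCK.
by case/orP=> /eqP->; [left|right].
Qed.

End NormalForm.

(** * Large traces *)

Section PingPong.
Variable R : realType.
Local Notation C := R[i].
Local Notation normc := (@ComplexField.Normc.normc R).
Variables (X : 'I_3 -> SL2 R) (t : C).
Hypothesis trX : forall i, \tr (val (X i)) = 0.
Hypothesis trXX : forall i j, i != j -> \tr (val (X i) *m val (X j)) = - t.
Hypothesis t5 : 5 <= normc t.
Implicit Types (c : 'I_3 -> C) (i j k : 'I_3) (s : seq 'I_3).

Definition comb c : 'M[C]_2 := \sum_j c j *: val (X j).

(* On sl2 a half-turn acts as minus the reflection in its axis vector. *)
Definition reflect i c : 'I_3 -> C :=
  fun j => if j == i then c i + t * \sum_(k | k != i) c k else - c j.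

(** The Gram matrix of the [X j] for the trace form. *)
Definition pairing i j : C := if j == i then - 2 else - t.

Lemma half_turn_sqr i : val (X i) *m val (X i) = - 1%:M.
Proof. exact: mx2_sqr (trX i) (SL2_det _). Qed.

Lemma tr_comb i c : \tr (val (X i) *m comb c) = \sum_j c j * pairing i j.
Proof.
rewrite mulmx_sumr raddf_sum /=; apply: eq_bigr => j _.
rewrite -scalemxAr linearZ /=; congr (_ * _); rewrite /pairing.
have [->|ij] := eqVneq j i; last by rewrite trXX // eq_sym.
by rewrite half_turn_sqr raddfN /= mxtrace_scalar.
Qed.

Lemma sum_pairing i c : \sum_j c j * pairing i j = - (c i * 2) - t * \sum_(k | k != i) c k.
Proof.
rewrite (bigD1 i) //= {1}/pairing eqxx mulrN; congr (_ + _).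
rewrite mulr_sumr -sumrN; apply: eq_bigr => j /negPf ji.
by rewrite /pairing ji mulrN mulrC.
Qed.

Lemma tr_comb0 c : \tr (comb c) = 0.
Proof. by rewrite raddf_sum /= big1 // => j _; rewrite linearZ /= trX mulr0. Qed.

Lemma comb_reflect i c : val (X i) *m comb c *m val (X i) = - comb (reflect i c).
Proof.
have e : comb c *m val (X i) = (\sum_j c j * pairing i j)%:M - val (X i) *m comb c.
  by rewrite -tr_comb; apply: mx2_anticomm; rewrite ?trX ?tr_comb0.
rewrite -mulmxA e mulmxBr mulmxA half_turn_sqr mulNmx mul1mx opprK mul_mx_scalar.
rewrite sum_pairing /comb [\sum_j c j *: _](bigD1 i) //=.
rewrite [\sum_j reflect i c j *: _](bigD1 i) //= opprD addrA -scalerDl.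
congr (_ + _).
  by rewrite -[RHS]scaleNr /reflect eqxx; congr (_ *: _); ring.
by rewrite -sumrN; apply: eq_bigr => j /negPf ji; rewrite /reflect ji scaleNr opprK.
Qed.

Definition word s : SL2 R := (\prod_(i <- s) X i)%g.
Definition orbit_comb c s := foldr reflect c s.

Lemma comb_word c s :
  val (word s) *m comb c *m invmx (val (word s)) = comb (orbit_comb c s).
Proof.
elim: s => [|i s IH]; first by rewrite /word big_nil mul1mx invmx1 mulmx1.
rewrite /word big_cons -/(word s) -[orbit_comb _ _]/(reflect i (orbit_comb c s)).
rewrite -[RHS]opprK -comb_reflect -IH.
have -> : invmx (val (X i * word s)%g) = invmx (val (word s)) *m invmx (val (X i)).
  by rewrite -!SL2_valV invgM.
have -> : invmx (val (X i)) = - val (X i).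
  by rewrite -[LHS]mul1mx -[1%:M]opprK -(half_turn_sqr i) mulNmx mulmxK ?SL2_unit.
by rewrite SL2_valM !mulmxN !mulmxA.
Qed.

(** The ping-pong sets: reflecting in i sends the set of any k <> i into that of i. *)
Definition dominant (m : R) i c :=
  m <= normc (c i) /\ forall j, j != i -> 3 * normc (c j) <= normc (c i).

Lemma ord3_others (i j : 'I_3) : i != j ->
  exists2 k, (k != i) && (k != j) & forall l, l != i -> l = j \/ l = k.
Proof.
rewrite -val_eqE => ij; have := ltn_ord i; have := ltn_ord j => ltj lti.
have vk : val (inord (3 - i - j) : 'I_3) = (3 - i - j)%N.
  by rewrite /= inordK //; move: ij => /=; lia.
exists (inord (3 - i - j)); first by rewrite -!val_eqE vk; move: ij => /=; lia.
move=> l; rewrite -val_eqE => li; have ltl := ltn_ord l.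
have [lj|lj] := eqVneq (val l) (val j); [left|right]; apply: val_inj => //.
by rewrite vk; move: ij li lj => /=; lia.
Qed.

Lemma normc_opp (x : C) : normc (- x) = normc x.
Proof. by case: x => a b /=; rewrite !sqrrN. Qed.

Lemma normc_sub_le (x y : C) : normc x - normc y <= normc (x + y).
Proof.
have := le_normcD (x + y) (- y).
by rewrite addrK normc_opp; lra.
Qed.

(** The new coordinate is c i + t (c k + c l) with |c i| and |c l| at most |c k| / 3, so its modulus
    is at least (10/3 - 1/3) |c k| = 3 |c k|. This is the origin of the constant 5. *)
Lemma dominant_reflect m i k c : i != k -> 0 < m -> dominant m k c ->
  dominant (3 * m) i (reflect i c).
Proof.
move=> ik m0 [mk Hk]; have [l /andP[li lk] Hl] := ord3_others ik.
have s : \sum_(j | j != i) c j = c k + c l.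
  rewrite (bigD1 k) /= ?(eq_sym k) // (bigD1 l) /= ?li ?lk // big1 ?addr0 //.
  by move=> j /andP[/andP[ji jk] jl]; have [/eqP|/eqP] := Hl j ji; [rewrite (negPf jk)|rewrite (negPf jl)].
have big : 3 * normc (c k) <= normc (reflect i c i).
  rewrite /reflect eqxx s addrC.
  have h1 := normc_sub_le (t * (c k + c l)) (c i).
  rewrite ComplexField.Normc.normcM in h1.
  have h2 := normc_sub_le (c k) (c l).
  have h3 := Hk _ ik; have h4 := Hk _ lk.
  have h5 : 5 * normc (c k + c l) <= normc t * normc (c k + c l).
    by apply: ler_wpM2r => //; case: (c k + c l) => a b; exact: sqrtr_ge0.
  by lra.
split; first by lra.
move=> j ji; rewrite {1}/reflect (negPf ji) normc_opp.
apply: le_trans big; rewrite ler_pM2l //.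
have [->//|jk] := eqVneq j k.
have := Hk j jk; have : 0 <= normc (c j) by case: (c j) => a b; exact: sqrtr_ge0.
by lra.
Qed.

Definition basis_comb k : 'I_3 -> C := fun j => (j == k)%:R.

(** The start is the axis vector of the last letter, which that letter fixes; growth sets in with
    the second letter applied, hence 1 and then 3. *)
Lemma dominant_word i s : sorted (fun i j => i != j) (i :: s) ->
  dominant (if s is [::] then 1 else 3) i (orbit_comb (basis_comb (last i s)) (i :: s)).
Proof.
elim: s i => [|j s IH] i /=.
  move=> _; have e j : reflect i (basis_comb i) j = if j == i then 1 else - 0.
    rewrite /reflect /basis_comb; case: (eqVneq j i) => // _.
    by rewrite eqxx big1 ?mulr0 ?addr0 // => k /negPf ->.
  split=> [|j /negPf ji]; rewrite !e eqxx ?ji ?oppr0 ComplexField.Normc.normc1 //.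
  by rewrite ComplexField.Normc.normc0 mulr0.
move=> /andP[ij ps]; have := IH j ps; set m := (X in dominant X j _) => Dj.
have m1 : 1 <= m by rewrite /m; case: (s) => [|? ?]; lra.
have [|Di1 Di2] := dominant_reflect ij _ Dj; first by lra.
by split=> //; apply: le_trans Di1; lra.
Qed.

Lemma word_neq1 s : s != [::] -> sorted (fun i j => i != j) s ->
  toPSL2 (word s) <> 1%g.
Proof.
case: s => [//|i s] _ srt /(@toPSL2_eq _ _ 1%g) W.
have [s0|s0] := eqVneq s [::].
  have : \tr (val (X i)) = \tr (val (word (i :: s))).
    by rewrite s0 /word big_cons big_nil mulg1.
  rewrite trX; case: W => ->; rewrite ?raddfN /= mxtrace_scalar => /esym/eqP;
    by rewrite ?oppr_eq0 pnatr_eq0.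
set k := last i s; have Dw := dominant_word srt.
set c := orbit_comb _ _ in Dw.
have {W}ec : comb c = comb (basis_comb k).
  have {}W : val (word (i :: s)) = 1%:M \/ val (word (i :: s)) = - 1%:M := W.
  rewrite -comb_word; case: W => ->; first by rewrite invmx1 mul1mx mulmx1.
  have -> : invmx (- 1%:M) = - 1%:M :> 'M[C]_2.
    by rewrite -scaleN1r invmxZ ?unitmxZ ?unitrN1 ?unitmx1 // invmx1 invrN1.
  by rewrite mulmxN !mulNmx opprK mulmx1 mul1mx.
have t2 : t - 2 != 0.
  apply/eqP => /subr0_eq e; move: t5; rewrite e.
  have := le_normcD (1 : C) 1; rewrite ComplexField.Normc.normc1 -[1 + 1 : C]/(2 : C).
  by lra.
(* Pairing with [X a] and [X b] recovers differences of coordinates without proving the [X j]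
   independent. *)
have ediff a b : c a - c b = basis_comb k a - basis_comb k b.
  have pr (d : 'I_3 -> C) : \tr (val (X a) *m comb d) - \tr (val (X b) *m comb d) =
      (t - 2) * (d a - d b).
    rewrite !tr_comb !sum_pairing.
    have -> : \sum_(j | j != a) d j = \sum_j d j - d a.
      by rewrite [\sum_j d j](bigD1 a) //= addrAC subrr add0r.
    have -> : \sum_(j | j != b) d j = \sum_j d j - d b.
      by rewrite [\sum_j d j](bigD1 b) //= addrAC subrr add0r.
    by ring.
  by apply: (mulfI t2); rewrite -!pr ec.
have {}Dw : dominant 3 i c by move: Dw; case: (s) s0.
case: Dw => D1 D2; have nonneg (x : C) : 0 <= normc x by case: x => a b; exact: sqrtr_ge0.
(* If i = k, then c i - c j = 1 contradicts |c i| >= 3 and |c j| <= |c i| / 3; otherwise the third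
   index j has c i = c j, against dominance. *)
have [ik|ik] := eqVneq i k.
  have [j] : exists j : 'I_3, j != i.
    exists (if i == 0 then 1 else 0); case: (eqVneq i 0) => [->//|]; by rewrite eq_sym.
  move=> ji; have := D2 j ji; have := ediff i j; rewrite /basis_comb ik eqxx -ik (negPf ji) subr0.
  move/(canRL (subrK _)) => e; move: D1; rewrite e => D1 D2'.
  have := le_normcD (1 : C) (c j); rewrite ComplexField.Normc.normc1 => H.
  have := nonneg (c j); lra.
have [j /andP[ji jk] _] := ord3_others ik.
have := ediff i j; rewrite /basis_comb (negPf ik) (negPf jk) subrr => /subr0_eq e.
by have := D2 j ji; rewrite -e; lra.
Qed.

Lemma large_free_product :
  free_product_of_cyclics (generated (range (fun i => toPSL2 (X i)))).
Proof.
apply: free_product_of_involutions => [i|s s0 srt].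
  rewrite toPSL2_mul; apply/toPSL2_eqP; rewrite /eq_up_to_sign.
  by rewrite SL2_valM half_turn_sqr eqxx orbT.
have -> : (\prod_(i <- s) toPSL2 (X i))%g = toPSL2 (word s).
  elim: s {s0 srt} => [|i s IH]; first by rewrite /word !big_nil.
  by rewrite /word !big_cons IH toPSL2_mul.
exact: word_neq1.
Qed.

End PingPong.

Lemma regular_triple_large (R : realType) (A B M : SL2 R) (t : R[i]) :
  5 <= ComplexField.Normc.normc t ->
  [/\ \tr (val A) = 0, \tr (val B) = 0 & \tr (val M) = 0] ->
  [/\ \tr (val A *m val B) = - t, \tr (val A *m val M) = - t &
      \tr (val M *m val B) = - t] ->
  free_product_of_cyclics (generated [set toPSL2 A; toPSL2 B; toPSL2 M]).
Proof.
move=> t5 [tA tB tM] [AB AM MB].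
pose X (i : 'I_3) := tnth [tuple A; B; M] i.
have I3 (P : 'I_3 -> Prop) : P 0 -> P 1 -> P 2 -> forall i, P i.
  move=> P0 P1 P2 [[|[|[|//]]] Hi].
  - by rewrite (_ : Ordinal Hi = 0) //; apply/val_inj.
  - by rewrite (_ : Ordinal Hi = 1) //; apply/val_inj.
  - by rewrite (_ : Ordinal Hi = 2) //; apply/val_inj.
have -> : [set toPSL2 A; toPSL2 B; toPSL2 M] = range (fun i => toPSL2 (X i)).
  apply/seteqP; split=> x.
    by move=> [[->|->]|->]; [exists 0|exists 1|exists 2].
  by move=> [i _ <-]; elim/I3: i; [left; left|left; right|right].
apply: (large_free_product _ _ t5).
  by elim/I3.
by elim/I3; elim/I3 => // _; rewrite mxtrace_mulC.
Qed.

(** * Quaternion algebras *)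

Section Span.
Variables (F : fieldType) (n : nat).

(** V is only a predicate, so a full rank matrix with rows in V is built row by row: a nonzero
    column of [cokermx M] is a linear form killing the rows of M, and an s in S not killed by it
    raises the rank. *)
Lemma span_full (S V : set 'rV[F]_n) :
  (forall t : 'cV[F]_n, (forall s, S s -> s *m t = 0) -> t = 0) ->
  V 0 -> (forall (c : F) u v, V u -> V v -> V (c *: u + v)) -> S `<=` V ->
  forall v, V v.
Proof.
move=> HS V0 VL SV.
have lin m (M : 'M[F]_(m, n)) : (forall i, V (row i M)) ->
    forall c : 'rV_m, V (c *m M).
  move=> HM c; rewrite mulmx_sum_row.
  apply: (big_ind V) => //; first by move=> x y Vx Vy; rewrite -[x]scale1r; apply: VL.
  by move=> i _; rewrite -[_ *: _]addr0; apply: VL.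
have step r : (r <= n)%N -> exists m (M : 'M[F]_(m, n)),
    (forall i, V (row i M)) /\ (r <= \rank M)%N.
  elim: r => [_|r IH rn]; first by exists 0%N, 0; split=> // -[].
  have [m [M [HM rM]]] := IH (ltnW rn).
  have [lt|ge] := ltnP r (\rank M); first by exists m, M.
  have : cokermx M != 0.
    rewrite -mxrank_eq0 mxrank_coker subn_eq0 -ltnNge.
    by apply: leq_trans rn; rewrite ltnS.
  move=> /matrix0Pn[a [b ab]].
  have [s [Ss st]] : exists s, S s /\ s *m col b (cokermx M) != 0.
    apply: contrapT => H; move: ab; suff /colP/(_ a) : col b (cokermx M) = 0.
      by rewrite !mxE => ->; rewrite eqxx.
    apply: HS => s Ss; apply/eqP; apply: contrapT => /negP ns.
    by apply: H; exists s.
  exists (m + 1)%N, (col_mx M s); split.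
    move=> i; case: (split_ordP i) => j ->; first by rewrite rowKu; exact: HM.
    by rewrite rowKd row_id; apply: SV.
  apply: leq_ltn_trans rM _; rewrite ltn_neqAle mxrankS ?andbT; last first.
    by rewrite -addsmxE addsmxSl.
  apply: contraNneq st => e.
  have : (col_mx M s <= M)%MS.
    by rewrite -(mxrank_leqif_sup _).2 ?e // -addsmxE addsmxSl.
  rewrite col_mx_sub => /andP[_ /submxP[c ->]].
  by rewrite colE -mulmxA (mulmxA M) mulmx_coker mul0mx mulmx0.
have [m [M [HM rM]]] := step n (leqnn n) => v.
have /submxP[c ->] : (v <= M)%MS.
  by apply: submx_full; rewrite /row_full eqn_leq rank_leq_col rM.
exact: lin.
Qed.

End Span.

Section QuatExt.
Variables (F F' : fieldType) (f : {rmorphism F -> F'}) (a b : F).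

Lemma quat_extM (x y : quat a b) :
  quat_ext f (x * y) = quat_ext f x * quat_ext f y.
Proof.
case: x y => [x0 x1 x2 x3] [y0 y1 y2 y3].
by congr Quat => /=; rewrite !(rmorphD, rmorphB, rmorphM, rmorphN).
Qed.

Lemma quat_extD (x y : quat a b) :
  quat_ext f (x + y) = quat_ext f x + quat_ext f y.
Proof. by congr Quat => /=; rewrite rmorphD. Qed.

Lemma quat_extN (x : quat a b) : quat_ext f (- x) = - quat_ext f x.
Proof. by congr Quat => /=; rewrite rmorphN. Qed.

Lemma quat_ext0 : quat_ext f 0 = 0 :> quat (f a) (f b).
Proof. by congr Quat => /=; rewrite rmorph0. Qed.

Lemma quat_ext1 : quat_ext f 1 = 1 :> quat (f a) (f b).
Proof. by congr Quat => /=; rewrite ?rmorph1 ?rmorph0. Qed.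

Lemma quat_extZ c (x : quat a b) : quat_ext f (c *: x) = f c *: quat_ext f x.
Proof. by congr Quat => /=; rewrite rmorphM. Qed.

Lemma reduced_norm_ext (x : quat a b) :
  reduced_norm (quat_ext f x) = f (reduced_norm x).
Proof. by rewrite /reduced_norm /= !(rmorphD, rmorphB, rmorphM, rmorphN, rmorphXn). Qed.

End QuatExt.

Definition qI (F : comNzRingType) (a b : F) : quat a b := Quat 0 1 0 0.
Definition qJ (F : comNzRingType) (a b : F) : quat a b := Quat 0 0 1 0.
Definition qK (F : comNzRingType) (a b : F) : quat a b := Quat 0 0 0 1.

Section MatrixQuat.
Variables (K : numFieldType) (a b : K).
Hypotheses (a0 : a != 0) (b0 : b != 0).
Local Notation H := (quat a b).
Implicit Types x y : H.

Local Notation qI := (qI a b).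
Local Notation qJ := (qJ a b).
Local Notation qK := (qK a b).

Lemma quat_decomp x : x = qre x *: 1 + qi x *: qI + qj x *: qJ + qij x *: qK.
Proof. by case: x => x0 x1 x2 x3; congr Quat => /=; ring. Qed.

(** The sum of e x e^-1 over the basis; the coefficients are the inverses of i^2 = a, j^2 = b and
    (ij)^2 = -ab. *)
Lemma quat_reE x : x + a^-1 *: (qI * x * qI) + b^-1 *: (qJ * x * qJ)
  - (a * b)^-1 *: (qK * x * qK) = (4 * qre x) *: 1.
Proof. by case: x => x0 x1 x2 x3; congr Quat => /=; field; rewrite ?a0 ?b0. Qed.

Definition quat_conj x : H := (2 * qre x) *: 1 - x.

Lemma quat_conjM x : x * quat_conj x = reduced_norm x *: 1.
Proof. by case: x => x0 x1 x2 x3; congr Quat => /=; rewrite /reduced_norm /=; ring. Qed.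

Variable Phi : {lrmorphism H -> 'M[K]_2}.

Lemma Phi_scalar c : Phi (c *: (1 : H)) = c%:M.
Proof. by rewrite linearZ /= rmorph1 scalemx1. Qed.

(** Each of i, j, ij is a multiple of a product of two anticommuting factors, so its image has trace
    0. *)
Lemma Phi_trace x : \tr (Phi x) = 2 * qre x.
Proof.
have two0 (c : K) : c = - c -> c = 0.
  by move/eqP; rewrite -addr_eq0 -mulr2n mulrn_eq0 /= => /eqP.
have II : qI * qI = a *: 1 by congr Quat => /=; ring.
have JJ : qJ * qJ = b *: 1 by congr Quat => /=; ring.
have IJ : qI * qJ = qK by congr Quat => /=; ring.
have JI : qJ * qI = - qK by congr Quat => /=; ring.
have tK : \tr (Phi qK) = 0.
  apply: two0; rewrite -[RHS]raddfN -[- Phi _]raddfN /= -JI -IJ !rmorphM.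
  by rewrite -!mulmxE mxtrace_mulC.
have tI : \tr (Phi qI) = 0.
  apply: two0; apply: (mulfI b0).
  transitivity (\tr (Phi (qJ * (qJ * qI)))).
    by rewrite mulrA JJ -scalerAl mul1r linearZ linearZ.
  rewrite rmorphM -mulmxE mxtrace_mulC mulmxE -rmorphM -mulrA IJ.
  by rewrite (_ : qJ * qK = - b *: qI) ?linearZ /= ?linearZ /= ?mulNr ?mulrN //; congr Quat => /=; ring.
have tJ : \tr (Phi qJ) = 0.
  apply: two0; apply: (mulfI a0).
  transitivity (\tr (Phi (qI * (qI * qJ)))).
    by rewrite mulrA II -scalerAl mul1r linearZ linearZ.
  rewrite rmorphM -mulmxE mxtrace_mulC mulmxE -rmorphM -mulrA JI.
  by rewrite (_ : qI * - qK = - a *: qJ) ?linearZ /= ?linearZ /= ?mulNr ?mulrN //; congr Quat => /=; ring.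
rewrite {1}[x]quat_decomp !rmorphD /= !linearZ /= !raddfD /= !linearZ /= tI tJ tK.
by rewrite rmorph1 mxtrace1 !mulr0 !addr0 mulrC.
Qed.

(** X (tr X - X) = det X by Cayley-Hamilton, and tr X - X is the image of the conjugate
    quaternion. *)
Lemma Phi_det x : \det (Phi x) = reduced_norm x.
Proof.
have : Phi x * Phi (quat_conj x) = (reduced_norm x)%:M.
  by rewrite -rmorphM /= quat_conjM Phi_scalar.
rewrite /quat_conj linearB /= Phi_scalar -Phi_trace mulrBr -!mulmxE mx2_cayley.
rewrite mul_mx_scalar opprB addrC subrK => /matrixP/(_ 0 0).
by rewrite !mxE.
Qed.

End MatrixQuat.

Section RationalConjugation.
Variables (k : fieldType) (K : numFieldType) (iota : {rmorphism k -> K}) (a b : k).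
Hypotheses (a0 : a != 0) (b0 : b != 0).
Variable Phi : {lrmorphism quat (iota a) (iota b) -> 'M[K]_2}.
Hypothesis PhiB : bijective Phi.
Local Notation ext := (quat_ext iota).

Let ia0 : iota a != 0. Proof. by rewrite fmorph_eq0. Qed.
Let ib0 : iota b != 0. Proof. by rewrite fmorph_eq0. Qed.

Lemma Phi_inj : injective Phi. Proof. exact: bij_inj. Qed.

(** Nondegeneracy descends from C to k: a linear form in the coordinates is y |-> re (q y), and re
    (q y) = q0 y0 + a q1 y1 + b q2 y2 - ab q3 y3 dictates the coordinates of q. *)
Lemma Phi_unit_dual (t : 'cV[k]_4) (S : set (quat a b)) :
  (forall T, (forall y, S y -> \tr (T *m Phi (ext y)) = 0) -> T = 0) ->
  (forall y, S y -> qre y * t 0 0 + qi y * t 1 0 + qj y * t 2 0 + qij y * t 3 0 = 0) ->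
  t = 0.
Proof.
move=> HS Ht.
pose q : quat (iota a) (iota b) := Quat (iota (t 0 0)) (iota (t 1 0) / iota a)
  (iota (t 2 0) / iota b) (- (iota (t 3 0) / (iota a * iota b))).
have /eqP : Phi q = 0.
  apply: HS => y /Ht e; rewrite mulmxE -rmorphM Phi_trace //=.
  apply/eqP; rewrite mulf_eq0 pnatr_eq0 /=; apply/eqP.
  transitivity (iota (qre y * t 0 0 + qi y * t 1 0 + qj y * t 2 0 + qij y * t 3 0)).
    by rewrite !(rmorphD, rmorphM); field; rewrite ?ia0 ?ib0.
  by rewrite e rmorph0.
rewrite -(rmorph0 Phi) (inj_eq Phi_inj) => /eqP[].
move=> /eqP; rewrite fmorph_eq0 => /eqP e0.
move=> /eqP; rewrite mulf_eq0 invr_eq0 (negPf ia0) orbF fmorph_eq0 => /eqP e1.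
move=> /eqP; rewrite mulf_eq0 invr_eq0 (negPf ib0) orbF fmorph_eq0 => /eqP e2.
move=> /eqP; rewrite oppr_eq0 mulf_eq0 invr_eq0 mulf_eq0 (negPf ia0) (negPf ib0) !orbF fmorph_eq0 => /eqP e3.
apply/colP => -[[|[|[|[|//]]]] Hi]; rewrite mxE.
- by rewrite -[RHS]e0; congr (t _ _); apply: val_inj.
- by rewrite -[RHS]e1; congr (t _ _); apply: val_inj.
- by rewrite -[RHS]e2; congr (t _ _); apply: val_inj.
- by rewrite -[RHS]e3; congr (t _ _); apply: val_inj.
Qed.

Lemma quat_span (S V : set (quat a b)) :
  (forall T, (forall y, S y -> \tr (T *m Phi (ext y)) = 0) -> T = 0) ->
  V 0 -> (forall c u v, V u -> V v -> V (c *: u + v)) -> S `<=` V ->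
  forall v, V v.
Proof.
move=> HS V0 VL SV v.
pose r (x : 'rV[k]_4) : quat a b := Quat (x 0 0) (x 0 1) (x 0 2) (x 0 3).
pose r' (x : quat a b) : 'rV[k]_4 :=
  \row_i nth 0 [:: qre x; qi x; qj x; qij x] i.
have rK x : r (r' x) = x by case: x => x0 x1 x2 x3; rewrite /r !mxE.
rewrite -(rK v); apply: (@span_full k 4 [set x | S (r x)] [set x | V (r x)]).
- move=> t Ht; apply: (@Phi_unit_dual t S) => // y Sy.
  have := Ht (r' y); rewrite /= rK => /(_ Sy)/matrixP/(_ 0 0).
  rewrite !mxE !big_ord_recr big_ord0 /= !mxE /= add0r => e; rewrite -[RHS]e.
  by congr (_ * t _ _ + _ * t _ _ + _ * t _ _ + _ * t _ _); apply: val_inj.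
- by rewrite /= (_ : r 0 = 0) // /r !mxE.
- move=> c u w /= Vu Vw; rewrite (_ : r _ = c *: r u + r w); first exact: VL.
  by rewrite /r !mxE.
- by move=> x; apply: SV.
Qed.

(* Skolem-Noether made explicit: conjugation by G being rational, so is
   sum_i (G e_i G^-1) p e_i^-1 = G (sum_i e_i G^-1 p e_i^-1), and the average
   over the quaternion basis e_i is the scalar 4 re (G^-1 p). *)
Lemma conj_rational (G : 'M[K]_2) : G \in unitmx ->
  (forall y : quat a b, exists y', Phi (ext y') = G *m Phi (ext y) *m invmx G) ->
  exists (x : quat a b) c, c != 0 /\ Phi (ext x) = c *: G.
Proof.
move=> uG HG; have [Psi PhiK PsiK] := PhiB.
pose g := Psi G; pose g' := Psi (invmx G).
have Pg : Phi g = G by rewrite PsiK.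
have Pg' : Phi g' = invmx G by rewrite PsiK.
have gg' : g * g' = 1.
  by apply: Phi_inj; rewrite rmorphM /= Pg Pg' rmorph1 -mulmxE mulmxV.
have {}HG y : exists y', ext y' = g * ext y * g'.
  have [y' e] := HG y; exists y'; apply: Phi_inj.
  by rewrite e !rmorphM /= Pg Pg' -!mulmxE.
have eI : ext (qI a b) = qI (iota a) (iota b) by congr Quat => /=; rewrite ?rmorph0 ?rmorph1.
have eJ : ext (qJ a b) = qJ (iota a) (iota b) by congr Quat => /=; rewrite ?rmorph0 ?rmorph1.
have eK : ext (qK a b) = qK (iota a) (iota b) by congr Quat => /=; rewrite ?rmorph0 ?rmorph1.
have [yI] := HG (qI a b); have [yJ] := HG (qJ a b); have [yK] := HG (qK a b).
rewrite eI eJ eK => hK hJ hI.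
have avg (p : quat a b) : exists x : quat a b, ext x = (4 * qre (g' * ext p)) *: g.
  exists (p + a^-1 *: (yI * p * qI a b) + b^-1 *: (yJ * p * qJ a b)
     - (a * b)^-1 *: (yK * p * qK a b)).
  have -> : (4 * qre (g' * ext p)) *: g = g * ((4 * qre (g' * ext p)) *: 1).
    by rewrite -scalerAr mulr1.
  rewrite -quat_reE // !mulrDr mulrN.
  rewrite !quat_extD quat_extN !quat_extZ !quat_extM eI eJ eK hI hJ hK.
  by rewrite !fmorphV rmorphM !scalerAr !mulrA gg' mul1r.
(* If re (g' e) vanished for all four basis elements e, so would g'. *)
have [p np] : exists p : quat a b, qre (g' * ext p) != 0.
  apply: contrapT => /forallNP nz.
  have {}nz p : qre (g' * ext p) = 0 by apply/eqP; apply: contrapT => /negP; apply: nz.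
  have := nz 1; have := nz (qI a b); have := nz (qJ a b); have := nz (qK a b).
  rewrite eI eJ eK quat_ext1 mulr1; case: (g') gg' => x0 x1 x2 x3 gg' /=.
  rewrite !mulr0 !mulr1 !add0r !addr0 !subr0 ?sub0r.
  move=> /eqP; rewrite oppr_eq0 !mulf_eq0 (negPf ia0) (negPf ib0) /= => /eqP z3.
  move=> /eqP; rewrite mulf_eq0 (negPf ib0) /= => /eqP z2.
  move=> /eqP; rewrite mulf_eq0 (negPf ia0) /= => /eqP z1 z0.
  move: gg'; rewrite z0 z1 z2 z3 -[Quat 0 0 0 0]/(0 : quat (iota a) (iota b)).
  by rewrite mulr0 => /eqP; rewrite eq_sym oner_eq0.
have [x ex] := avg p; exists x, (4 * qre (g' * ext p)); split.
  by rewrite mulf_neq0 ?pnatr_eq0.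
by rewrite ex linearZ /= Pg.
Qed.

End RationalConjugation.

(** * Invariant trace field *)

Section RealPlaces.
Variable R : realType.
Implicit Types (al be : R).

(** Such an h has real part 0, and its square is minus a nonzero sum of squares. *)
Lemma hamilton_sqr (h : quat (-1 : R) (-1)) c : h * h = c *: 1 ->
  (forall r, h <> r *: 1) -> c < 0.
Proof.
case: h => r x y z e ns.
have [e0 e1 e2 e3] : [/\ r * r - (x * x + y * y + z * z) = c, r * x * 2 = 0, r * y * 2 = 0
    & r * z * 2 = 0].
  by case: e => e0 e1 e2 e3; split; [rewrite -[c]mulr1 -e0; ring|rewrite -[RHS](mulr0 c) -e1; ring
    |rewrite -[RHS](mulr0 c) -e2; ring|rewrite -[RHS](mulr0 c) -e3; ring].
have r0 : r = 0.
  apply: contrapT => /eqP r0; apply: (ns r).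
  have z0 u : r * u * 2 = 0 -> u = 0.
    by move/eqP; rewrite !mulf_eq0 (negPf r0) pnatr_eq0 orbF => /eqP.
  by rewrite (z0 _ e1) (z0 _ e2) (z0 _ e3); congr Quat => /=; rewrite ?mulr1 ?mulr0.
rewrite -e0 r0 mul0r sub0r oppr_lt0 -!expr2.
have [x0|x0] := eqVneq x 0; last first.
  by rewrite -addrA ltr_wpDr ?addr_ge0 ?sqr_ge0 // exprn_even_gt0.
have [y0|y0] := eqVneq y 0; last first.
  by rewrite x0 expr0n add0r ltr_wpDr ?sqr_ge0 // exprn_even_gt0.
have [z0|z0] := eqVneq z 0; last first.
  by rewrite x0 y0 expr0n !add0r exprn_even_gt0.
by case: (ns 0); rewrite r0 x0 y0 z0; congr Quat => /=; rewrite mul0r.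
Qed.

Lemma ramified_neg al be (Psi : {lrmorphism quat al be -> quat (-1 : R) (-1)}) :
  injective Psi -> al < 0 /\ be < 0.
Proof.
move=> PsiI; split.
  apply: (@hamilton_sqr (Psi (qI al be))).
    rewrite -rmorphM /= (_ : _ * _ = al *: (1 : quat al be)); last by congr Quat => /=; ring.
    by rewrite linearZ /= rmorph1.
  move=> r; rewrite -(rmorph1 Psi) -linearZ => /PsiI[_ /eqP].
  by rewrite mulr0 oner_eq0.
apply: (@hamilton_sqr (Psi (qJ al be))).
  rewrite -rmorphM /= (_ : _ * _ = be *: (1 : quat al be)); last by congr Quat => /=; ring.
  by rewrite linearZ /= rmorph1.
move=> r; rewrite -(rmorph1 Psi) -linearZ => /PsiI[_ _ /eqP].
by rewrite mulr0 oner_eq0.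
Qed.

Lemma reduced_norm_pos al be (x : quat al be) : al < 0 -> be < 0 ->
  reduced_norm x != 0 -> 0 < reduced_norm x.
Proof.
move=> al0 be0 n0; rewrite lt_def n0 /reduced_norm.
have ab : 0 < al * be by rewrite nmulr_rgt0.
have h0 : 0 <= qre x ^+ 2 by exact: sqr_ge0.
have h1 : 0 <= - al * qi x ^+ 2 by rewrite mulr_ge0 ?sqr_ge0 // oppr_ge0 ltW.
have h2 : 0 <= - be * qj x ^+ 2 by rewrite mulr_ge0 ?sqr_ge0 // oppr_ge0 ltW.
have h3 : 0 <= al * be * qij x ^+ 2 by rewrite mulr_ge0 ?sqr_ge0 // ltW.
by lra.
Qed.

(* The Gram matrix of three vectors in a definite ternary form has nonnegative
   determinant, and here it is proportional to [(1 - r)^2 (1 + 2 r)]. *)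
Lemma gram_bound al be (x y z : quat al be) r : al < 0 -> be < 0 ->
  [/\ qre x = 0, qre y = 0 & qre z = 0] ->
  [/\ reduced_norm x != 0, reduced_norm y != 0 & reduced_norm z != 0] ->
  [/\ qre (x * y) ^+ 2 = r ^+ 2 * (reduced_norm x * reduced_norm y),
      qre (x * z) ^+ 2 = r ^+ 2 * (reduced_norm x * reduced_norm z) &
      qre (z * y) ^+ 2 = r ^+ 2 * (reduced_norm z * reduced_norm y)] ->
  qre (x * y) * qre (x * z) * qre (z * y) =
    - r ^+ 3 * (reduced_norm x * reduced_norm y * reduced_norm z) ->
  -1 <= 2 * r <= 2.
Proof.
move=> al0 be0 [x0 y0 z0] [nx ny nz] [exy exz ezy] e3.
have {}nx := reduced_norm_pos al0 be0 nx.
have {}ny := reduced_norm_pos al0 be0 ny.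
have {}nz := reduced_norm_pos al0 be0 nz.
have ab : 0 < al * be by rewrite nmulr_rgt0.
(* Cauchy-Schwarz for x and y gives the upper bound, which the Gram determinant cannot. *)
have r1 : r ^+ 2 <= 1.
  have : 0 <= (1 - r ^+ 2) * (reduced_norm x * reduced_norm y).
    rewrite mulrBl mul1r -exy; case: (x) (y) x0 y0 {nx ny exy exz ezy e3} => ? x1 x2 x3 [? y1 y2 y3] /= -> ->.
    rewrite /reduced_norm /= (_ : _ - _ = (al * be) * (x1 * y2 - x2 * y1) ^+ 2
      + (al * be) * ((- al) * (x1 * y3 - x3 * y1) ^+ 2 + (- be) * (x2 * y3 - x3 * y2) ^+ 2)); last by ring.
    apply: addr_ge0; first by rewrite mulr_ge0 ?sqr_ge0 // ltW.
    apply: mulr_ge0; first exact: ltW.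
    by apply: addr_ge0; rewrite mulr_ge0 ?sqr_ge0 // oppr_ge0 ltW.
  by rewrite pmulr_lge0 ?mulr_gt0 // subr_ge0.
have g : 0 <= (1 - r) ^+ 2 * (1 + 2 * r).
  have : 0 <= ((1 - r) ^+ 2 * (1 + 2 * r)) * (reduced_norm x * reduced_norm y * reduced_norm z).
    have -> : ((1 - r) ^+ 2 * (1 + 2 * r)) * (reduced_norm x * reduced_norm y * reduced_norm z)
      = reduced_norm x * reduced_norm y * reduced_norm z
        - 2 * (qre (x * y) * qre (x * z) * qre (z * y))
        - reduced_norm x * qre (z * y) ^+ 2 - reduced_norm y * qre (x * z) ^+ 2
        - reduced_norm z * qre (x * y) ^+ 2.
      by rewrite e3 exy exz ezy; ring.
    case: (x) (y) (z) x0 y0 z0 {nx ny nz exy exz ezy e3} => ? x1 x2 x3 [? y1 y2 y3] [? z1 z2 z3] /= -> -> ->.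
    (* The Gram determinant is (al be)^2 times the squared determinant of the coordinates. *)
    rewrite /reduced_norm /= (_ : _ - _ = (al * be * (x1 * (y2 * z3 - y3 * z2)
      - x2 * (y1 * z3 - y3 * z1) + x3 * (y1 * z2 - y2 * z1))) ^+ 2); last by ring.
    exact: sqr_ge0.
  by rewrite pmulr_lge0 ?mulr_gt0.
have rl : r <= 1 by nra.
apply/andP; split; last by lra.
have [->|r1'] := eqVneq r 1; first by lra.
have : 0 < (1 - r) ^+ 2 by rewrite exprn_even_gt0 //= subr_eq0 eq_sym.
by move=> h; move: g; rewrite pmulr_rge0 //; lra.
Qed.

End RealPlaces.

(** * Elements of the group as multiples of quaternions over k *)

Section ArithmeticLift.
Variables (R : realType) (k : fieldExtType rat) (iota : {rmorphism k -> R[i]}).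
Variables (a b : k) (Phi : {lrmorphism quat (iota a) (iota b) -> 'M[R[i]]_2}).
Variables (O : set (quat a b)).
Hypotheses (a0 : a != 0) (b0 : b != 0) (PhiB : bijective Phi).

(** For X in F, both X and G X G^-1 are, up to sign, images of quaternions over k. Those quaternions
    span the algebra, so conjugation by G is rational and [conj_rational] applies. *)
Lemma arithmetic_lift (D E : set (PSL2 R)) (G : SL2 R) :
  is_subgroup D -> is_subgroup E -> D `<=` E ->
  commensurable E (norm1_image Phi O) ->
  ~ virtually_abelian D -> (forall v, v != 0 -> ~ D `<=` line_stabilizer v) ->
  D (toPSL2 G) ->
  exists (x : quat a b) c, c != 0 /\ Phi (quat_ext iota x) = c *: val G.
Proof.
move=> sD sE DE [D0 [D0E [_ D0O _]]] nD irr DG.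
have FD := finite_index_conj D0E sE sD DE (DE _ DG).
set F := [set x | _] in FD.
have unsign (X : SL2 R) : D0 (toPSL2 X) -> exists (y : quat a b) (Z : SL2 R),
    [/\ toPSL2 Z = toPSL2 X, val Z = Phi (quat_ext iota y) &
        val X = Phi (quat_ext iota y) \/ val X = - Phi (quat_ext iota y)].
  move=> /D0O[Z [y [_ _ eZ]] e]; exists y, Z; split=> //.
  by rewrite -eZ; apply: toPSL2_eq.
pose S := [set y : quat a b | exists2 X : SL2 R, F (toPSL2 X) & val X = Phi (quat_ext iota y)].
apply: (conj_rational a0 b0 PhiB (SL2_unit G)).
have Psub (c : R[i]) u v : Phi (c *: u + v) = c *: Phi u + Phi v by rewrite linearP.
apply: (@quat_span _ _ iota a b a0 b0 Phi PhiB S).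
- move=> T HT; apply: (lifts_irreducible sD FD nD irr) => _ [X FX <-].
  have [_ D0X _] := FX; have [y [Z [eZ vZ sZ]]] := unsign _ D0X.
  have : \tr (T *m Phi (quat_ext iota y)) = 0 by apply: HT; exists Z; rewrite // eZ.
  by case: sZ => ->; rewrite ?mulmxN ?raddfN /= => ->; rewrite ?oppr0.
- by exists 0; rewrite quat_ext0 rmorph0 mulmx0 mul0mx.
- move=> c u v [u' eu] [v' ev]; exists (c *: u' + v').
  rewrite !quat_extD !quat_extZ !Psub eu ev mulmxDr mulmxDl.
  by rewrite -scalemxAr -scalemxAl.
- move=> y [X [DX D0X D0GX] eX].
  have eGX : (toPSL2 G * toPSL2 X * (toPSL2 G)^-1)%g = toPSL2 (G * X * G^-1)%g.
    by rewrite (toPSL2_inv G) (toPSL2_mul G X) (toPSL2_mul (G * X)%g).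
  move: D0GX; rewrite eGX => /unsign[y' [Z [_ _ sZ]]].
  have vG : val (G * X * G^-1)%g = val G *m Phi (quat_ext iota y) *m invmx (val G) by rewrite -eX.
  case: sZ => sZ; first by exists y'; rewrite -sZ.
  by exists (- y'); rewrite quat_extN rmorphN -[LHS]/(- Phi _) -sZ.
Qed.

End ArithmeticLift.

Section TraceField.
Variables (R : realType) (k : fieldExtType rat) (iota : {rmorphism k -> R[i]}).
Variables (a b : k) (Phi : {lrmorphism quat (iota a) (iota b) -> 'M[R[i]]_2}).
Hypotheses (a0 : a != 0) (b0 : b != 0).
Hypothesis real_ramified : forall phi : {rmorphism k -> R},
  exists Psi : {lrmorphism quat (phi a) (phi b) -> quat (-1 : R) (-1)}, bijective Psi.

(** The scalars need not come from k, but their squares are norms. Hence the Gram entries are used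
    squared, and the product of all three keeps the sign of t that squaring loses. *)
Lemma regular_triple_trace_field (A B M : SL2 R) (t : R[i]) :
  (forall G, G \in [:: A; B; M] -> exists (x : quat a b) c,
     c != 0 /\ Phi (quat_ext iota x) = c *: val G) ->
  [/\ \tr (val A) = 0, \tr (val B) = 0 & \tr (val M) = 0] ->
  [/\ \tr (val A *m val B) = - t, \tr (val A *m val M) = - t &
      \tr (val M *m val B) = - t] ->
  exists2 w, iota w = t & forall phi : {rmorphism k -> R}, -1 <= phi w <= 2.
Proof.
move=> HG [tA tB tM] [AB AM MB].
have ia0 : iota a != 0 by rewrite fmorph_eq0.
have ib0 : iota b != 0 by rewrite fmorph_eq0.
have n2 : 2 != 0 :> R[i] by rewrite pnatr_eq0.
have [|x [cx [cx0 ex]]] := HG A; first by rewrite !inE eqxx.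
have [|y [cy [cy0 ey]]] := HG B; first by rewrite !inE eqxx orbT.
have [|z [cz [cz0 ez]]] := HG M; first by rewrite !inE eqxx !orbT.
have pure (u : quat a b) c (G : SL2 R) : Phi (quat_ext iota u) = c *: val G ->
    \tr (val G) = 0 -> qre u = 0.
  move=> e tG; have := Phi_trace ia0 ib0 Phi (quat_ext iota u).
  rewrite e linearZ /= tG mulr0 => /esym/eqP.
  by rewrite mulf_eq0 (negPf n2) fmorph_eq0 => /eqP.
have nrm (u : quat a b) c (G : SL2 R) : Phi (quat_ext iota u) = c *: val G ->
    iota (reduced_norm u) = c ^+ 2.
  move=> e; rewrite -reduced_norm_ext -(Phi_det ia0 ib0 Phi) e detZ SL2_det.
  by rewrite mulr1.
have prd (u v : quat a b) c d (G H : SL2 R) : Phi (quat_ext iota u) = c *: val G ->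
    Phi (quat_ext iota v) = d *: val H -> \tr (val G *m val H) = - t ->
    iota (qre (u * v)) = - (c * d * (t / 2)).
  move=> eu ev GH; apply: (mulfI n2).
  have := Phi_trace ia0 ib0 Phi (quat_ext iota (u * v)) => /= <-.
  rewrite quat_extM rmorphM /= eu ev -mulmxE -scalemxAr -scalemxAl !mxtraceZ GH.
  by field.
have x0 := pure _ _ _ ex tA; have y0 := pure _ _ _ ey tB; have z0 := pure _ _ _ ez tM.
have nx := nrm _ _ _ ex; have ny := nrm _ _ _ ey; have nz := nrm _ _ _ ez.
have pxy := prd _ _ _ _ _ _ ex ey AB; have pxz := prd _ _ _ _ _ _ ex ez AM.
have pzy := prd _ _ _ _ _ _ ez ey MB.
have nx0 : reduced_norm x != 0 by rewrite -(fmorph_eq0 iota) nx expf_eq0.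
have ny0 : reduced_norm y != 0 by rewrite -(fmorph_eq0 iota) ny expf_eq0.
have nz0 : reduced_norm z != 0 by rewrite -(fmorph_eq0 iota) nz expf_eq0.
have [r ir] : exists r, iota r = t / 2.
  have [->|t0] := eqVneq t 0; first by exists 0; rewrite rmorph0 mul0r.
  (* The scalars [cx], [cy], [cz] cancel here, leaving t / 2. *)
  exists (- (qre (x * z) * qre (z * y)) / (qre (x * y) * reduced_norm z)).
  rewrite fmorph_div rmorphN !rmorphM /= pxy pxz pzy nz; field.
  by rewrite t0 cz0 cx0 cy0.
exists (2 * r); first by rewrite rmorphM rmorph_nat /= ir; field.
move=> phi; have [Psi PsiB] := real_ramified phi.
have [al0 be0] := ramified_neg (bij_inj PsiB).
have [exy exz ezy] : [/\ qre (x * y) ^+ 2 = r ^+ 2 * (reduced_norm x * reduced_norm y),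
      qre (x * z) ^+ 2 = r ^+ 2 * (reduced_norm x * reduced_norm z) &
      qre (z * y) ^+ 2 = r ^+ 2 * (reduced_norm z * reduced_norm y)].
  by split; apply: (fmorph_inj iota); rewrite !(rmorphXn, rmorphM) /= ?rmorphXn /= ir ?nx ?ny ?nz ?pxy ?pxz ?pzy; ring.
have e3 : qre (x * y) * qre (x * z) * qre (z * y) =
    - r ^+ 3 * (reduced_norm x * reduced_norm y * reduced_norm z).
  by apply: (fmorph_inj iota); rewrite !(rmorphN, rmorphM) /= ?rmorphXn /= ir ?nx ?ny ?nz ?pxy ?pxz ?pzy; ring.
rewrite rmorphM rmorph_nat.
have pe (u v : quat a b) : qre (quat_ext phi u * quat_ext phi v) = phi (qre (u * v)).
  by rewrite -quat_extM.
apply: (@gram_bound _ _ _ (quat_ext phi x) (quat_ext phi y) (quat_ext phi z) (phi r)) => //.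
- by rewrite /= x0 y0 z0 rmorph0.
- by rewrite !reduced_norm_ext !fmorph_eq0.
- by rewrite !pe !reduced_norm_ext -!rmorphXn -!rmorphM /= exy exz ezy.
- by rewrite !pe !reduced_norm_ext -!rmorphXn -rmorphN -!rmorphM /= e3.
Qed.

End TraceField.

(** * Integrality of traces *)

Section IntegralPoly.
Variables (K : idomainType).
Local Notation integral := (integralOver (intr : int -> K)).

Definition integral_coefs (p : {poly K}) := forall i, integral p`_i.

Lemma integral_bigsum (I : Type) (r : seq I) (P : pred I) (F : I -> K) :
  (forall i, P i -> integral (F i)) -> integral (\sum_(i <- r | P i) F i).
Proof.
by move=> H; apply: big_ind => //; [exact: mxpoly.integral0|exact: mxpoly.integral_add].
Qed.

Lemma integral_coefsD p q :
  integral_coefs p -> integral_coefs q -> integral_coefs (p + q).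
Proof. by move=> Hp Hq i; rewrite coefD; apply: mxpoly.integral_add. Qed.

Lemma integral_coefsN p : integral_coefs p -> integral_coefs (- p).
Proof. by move=> Hp i; rewrite coefN; apply: integral_opp. Qed.

Lemma integral_coefsM p q :
  integral_coefs p -> integral_coefs q -> integral_coefs (p * q).
Proof.
by move=> Hp Hq i; rewrite coefM; apply: integral_bigsum => j _; apply: integral_mul.
Qed.

Lemma integral_coefsC c : integral c -> integral_coefs c%:P.
Proof. by move=> Hc i; rewrite coefC; case: eqP => // _; exact: mxpoly.integral0. Qed.

Lemma integral_coefsXn n : integral_coefs 'X^n.
Proof. by move=> i; rewrite coefXn; exact: integral_nat. Qed.

Lemma integral_coefs_char_poly n (A : 'M[K]_n) :
  (forall i j, integral (A i j)) -> integral_coefs (char_poly A).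
Proof.
move=> HA; apply: (big_ind integral_coefs).
- by rewrite -polyC0; apply: integral_coefsC; exact: mxpoly.integral0.
- exact: integral_coefsD.
move=> s _; apply: integral_coefsM.
  case: (perm.odd_perm s); rewrite ?expr1 ?expr0.
    by apply: integral_coefsN; rewrite -polyC1; apply: integral_coefsC; exact: mxpoly.integral1.
  by rewrite -polyC1; apply: integral_coefsC; exact: mxpoly.integral1.
apply: (big_ind integral_coefs).
- by rewrite -polyC1; apply: integral_coefsC; exact: mxpoly.integral1.
- exact: integral_coefsM.
move=> i _; rewrite !mxE; apply: integral_coefsD.
  move=> j; rewrite coefMn; case: (_ == _); last exact: mxpoly.integral0.
  by rewrite coefX; exact: integral_nat.
by apply: integral_coefsN; apply: integral_coefsC.
Qed.

Lemma integral_root_coefs u p : p \is monic -> root p u -> integral_coefs p -> integral u.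
Proof.
move=> mp rp Hp; apply: (integral_root_monic mp rp) => _ /(nthP 0)[i _ <-].
exact: Hp.
Qed.

Lemma integral_exp (u : K) n : integral (u ^+ n.+1) -> integral u.
Proof.
move=> Hu; apply: (@integral_root_coefs u ('X^(n.+1) - (u ^+ n.+1)%:P)).
- exact: monicXnsubC.
- by rewrite /root !hornerE subrr.
- by apply: integral_coefsD; [exact: integral_coefsXn|apply/integral_coefsN/integral_coefsC].
Qed.

End IntegralPoly.

Section Orders.
Variables (R : realType) (k : fieldExtType rat) (iota : {rmorphism k -> R[i]}).
Variables (a b : k) (Phi : {lrmorphism quat (iota a) (iota b) -> 'M[R[i]]_2}).
Variables (O : set (quat a b)).
Hypotheses (ordO : is_order O).
Local Notation C := R[i].
Local Notation integral := (integralOver (intr : int -> C)).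

(** Multiplication by x on generators e_i of O has integral coefficients, and the rows l e_i give an
    eigenvector of that matrix for lam. They are not all zero, as 1 is in O. *)
Lemma order_eigenvalue_integral x (l : 'rV[C]_2) lam : O x -> l != 0 ->
  l *m Phi (quat_ext iota x) = lam *: l -> integral lam.
Proof.
case: ordO => O1 OBM [n [e eO]] _ Ox l0 el.
have Oe i : O (e i).
  rewrite eO; exists (fun j => (j == i)%:R) => [j|]; first exact: integral_nat.
  rewrite (bigD1 i) //= eqxx scale1r big1 ?addr0 // => j /negPf ->.
  by rewrite scale0r.
have /choice[c Hc] : forall i, exists c : 'I_n -> k,
    (forall j, ring_of_integers (c j)) /\ x * e i = \sum_j c j *: e j.
  move=> i; have [_] := OBM _ _ Ox (Oe i).
  by rewrite {1}eO => -[c Hc ec]; exists c.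
pose f i := l *m Phi (quat_ext iota (e i)).
have ext_sum (d : 'I_n -> k) : Phi (quat_ext iota (\sum_j d j *: e j)) =
    \sum_j iota (d j) *: Phi (quat_ext iota (e j)).
  elim/big_ind2: _ => [|u u' v v' eu ev|j _]; first by rewrite quat_ext0 rmorph0.
    by rewrite quat_extD raddfD -eu -ev.
  by rewrite quat_extZ linearZ.
have lf i : lam *: f i = \sum_j iota (c i j) *: f j.
  rewrite /f scalemxAl -el -mulmxA.
  have -> : Phi (quat_ext iota x) *m Phi (quat_ext iota (e i)) = Phi (quat_ext iota (x * e i)).
    by rewrite quat_extM rmorphM.
  rewrite (Hc i).2 ext_sum mulmx_sumr; apply: eq_bigr => j _.
  by rewrite -scalemxAr.
have [p [i fp]] : exists p i, f i 0 p != 0.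
  apply: contrapT => H; move: l0; apply/negP; rewrite negbK; apply/eqP.
  have : O 1 by []. rewrite eO => -[d _ e1].
  have -> : l = \sum_j iota (d j) *: f j.
    transitivity (l *m Phi (quat_ext iota 1)).
      by rewrite quat_ext1 rmorph1 mulmx1.
    by rewrite e1 ext_sum mulmx_sumr; apply: eq_bigr => j _; rewrite -scalemxAr.
  apply: big1 => j _; suff -> : f j = 0 by rewrite scaler0.
  apply/rowP => p; rewrite [RHS]mxE; apply/eqP/negPn/negP => fp.
  by apply: H; exists p, j.
pose A : 'M[k]_n := \matrix_(i, j) c j i.
have ev : eigenvalue (map_mx iota A) lam.
  apply/eigenvalueP; exists (\row_i f i 0 p); last first.
    by apply: contraNneq fp => /rowP/(_ i); rewrite !mxE => ->.
  apply/rowP => j; rewrite !mxE.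
  have /rowP/(_ p) := lf j; rewrite !mxE summxE => ->.
  by apply: eq_bigr => j' _; rewrite !mxE mulrC.
move: ev; rewrite eigenvalue_root_char -map_char_poly => rA.
apply: (integral_root_coefs _ rA).
  by rewrite map_monic char_poly_monic.
move=> j; rewrite coef_map /=.
have [|q mq rq] := (@integral_coefs_char_poly k n A _ j).
  by move=> i' j'; rewrite mxE; apply: (Hc j').1.
exists q => //; move: rq => /(rmorph_root iota); rewrite -map_poly_comp.
by rewrite (eq_map_poly (_ : _ =1 (intr : int -> C))) // => z /=; rewrite rmorph_int.
Qed.

Lemma SL2_row_eigenvector (G : SL2 R) lam : lam ^+ 2 - \tr (val G) * lam + 1 = 0 ->
  exists2 l : 'rV[C]_2, l != 0 & l *m val G = lam *: l.
Proof.
move=> e; have /eqP/det0P[l l0 el] : \det (val G - lam%:M) = 0.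
  rewrite -[RHS]e; move: (SL2_det G); elim/mx2_ind: (val G) => x y z w.
  by rewrite !mx2_simpl => <-; ring.
by exists l => //; apply/eqP; rewrite -subr_eq0 -mul_mx_scalar -mulmxBr el.
Qed.

(** Only a power of G comes from the order, up to sign. Eigenvalues pass through this: lam is
    integral once a power is, and the trace is lam + lam^-1. *)
Lemma arithmetic_trace_integral (D E : set (PSL2 R)) (G : SL2 R) :
  is_subgroup E -> commensurable E (norm1_image Phi O) -> E (toPSL2 G) ->
  integral (\tr (val G)).
Proof.
move=> sE [D0 [D0E [_ D0O _]]] EG.
have [n] := finite_index_expg sE D0E EG.
rewrite toPSL2_exp => /D0O[Z [x [Ox _ eZ]] /esym/toPSL2_eq sgn].
have lin lam : lam ^+ 2 - \tr (val G) * lam + 1 = 0 -> integral lam.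
  move=> /SL2_row_eigenvector[l l0 el]; apply: (@integral_exp _ lam n).
  have eln : l *m val (G ^+ n.+1)%g = lam ^+ n.+1 *: l.
    elim: n.+1 => [|m IH]; first by rewrite expg0 expr0 scale1r mulmx1.
    by rewrite expgSr SL2_valM mulmxA IH -scalemxAl el scalerA -exprSr.
  rewrite eZ in sgn; case: sgn => sgn; rewrite sgn in eln.
    exact: order_eigenvalue_integral Ox l0 eln.
  rewrite -[lam ^+ _]opprK; apply: integral_opp.
  by apply: order_eigenvalue_integral Ox l0 _; rewrite scaleNr -eln mulmxN opprK.
set t := \tr (val G) in lin *.
pose lam := (t + sqrtC (t ^+ 2 - 4)) / 2.
have n2 : 2 != 0 :> C by rewrite pnatr_eq0.
have e : lam ^+ 2 - t * lam + 1 = 0.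
  have s := sqrtCK (t ^+ 2 - 4).
  transitivity ((sqrtC (t ^+ 2 - 4) ^+ 2 - (t ^+ 2 - 4)) / 4); first by rewrite /lam; field.
  by rewrite s subrr mul0r.
have lam0 : lam != 0.
  by apply: contra_eqN e => /eqP->; rewrite expr0n mulr0 subr0 add0r oner_eq0.
have -> : t = lam + lam^-1.
  by apply: (mulIf lam0); rewrite mulrDl mulVf // -expr2; apply/esym/eqP;
     rewrite -subr_eq0 addrAC e.
apply: mxpoly.integral_add; apply: lin => //.
transitivity ((lam ^+ 2 - t * lam + 1) / lam ^+ 2); first by field.
by rewrite e mul0r.
Qed.

End Orders.

(** * Embeddings of number fields *)

Lemma rmorphism_of (A B : nzRingType) (f : A -> B) :
  (forall x y, f (x - y) = f x - f y) -> (forall x y, f (x * y) = f x * f y) ->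
  f 1 = 1 -> exists g : {rmorphism A -> B}, g =1 f.
Proof.
move=> fB fM f1.
pose addM := GRing.isZmodMorphism.Build A B f fB.
pose mulM := GRing.isMonoidMorphism.Build A B f (f1, fM).
pose g : {rmorphism A -> B} := HB.pack f addM mulM.
by exists g.
Qed.

Section RegularRepresentation.
Import VectorInternalTheory.
Variables (F : fieldType) (k : fieldExtType F).

Definition is_representation n (M : k -> 'M[F]_n) :=
  [/\ (forall x y, M (x - y) = M x - M y), (forall x y, M (x * y) = M x *m M y),
      (forall c x, M (c *: x) = c *: M x), M 1 = 1%:M & forall x, M x = 0 -> x = 0].

Lemma representation_of_coordinates n (f : {linear k -> 'rV[F]_n}) (g : {linear 'rV[F]_n -> k}) :
  cancel f g -> cancel g f -> exists M : k -> 'M[F]_n, is_representation M.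
Proof.
move=> fK gK.
pose M x : 'M[F]_n := \matrix_i f (x * g (delta_mx 0 i)).
have ME x u : u *m M x = f (x * g u).
  rewrite mulmx_sum_row {2}[u]row_sum_delta linear_sum mulr_sumr linear_sum.
  by apply: eq_bigr => i _; rewrite rowK /= linearZ /= -scalerAr linearZ.
have ext A B : (forall u : 'rV_n, u *m A = u *m B) -> A = B :> 'M[F]_n.
  by move=> H; apply/row_matrixP => i; rewrite !rowE H.
exists M; split.
- by move=> x y; apply: ext => u; rewrite mulmxBr !ME mulrBl linearB.
- by move=> x y; apply: ext => u; rewrite mulmxA !ME fK mulrCA mulrA (mulrC x).
- by move=> c x; apply: ext => u; rewrite -scalemxAr !ME -scalerAl linearZ.
- by apply: ext => u; rewrite ME mul1r gK mulmx1.
- move=> x Mx0; have := ME x (f 1); rewrite Mx0 mulmx0 fK mulr1 => /esym e.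
  by rewrite -(fK x) e linear0.
Qed.

Lemma vector_coordinates (V : vectType F) : exists n
    (f : {linear V -> 'rV[F]_n}) (g : {linear 'rV[F]_n -> V}),
  cancel f g /\ cancel g f.
Proof.
pose f : {linear V -> 'rV[F]_(dim V)} := @v2r _ V.
pose g : {linear 'rV[F]_(dim V) -> V} := @r2v _ V.
by exists (dim V), f, g; split; [exact: v2rK|exact: r2vK].
Qed.

Lemma regular_representation : exists n (M : k -> 'M[F]_n.+1), is_representation M.
Proof.
have [n [f [g [fK gK]]]] := vector_coordinates k.
have [M HM] := representation_of_coordinates fK gK.
move: n M HM {f g fK gK} => [|n] M HM; last by exists n, M.
case: HM => _ _ _ _ /(_ 1) H; have /eqP := oner_neq0 k; case; apply: H.
exact: flatmx0.
Qed.

End RegularRepresentation.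

Section CommonEigenvector.
Variables (C : closedFieldType) (I : Type) (n : nat) (M : I -> 'M[C]_n).
Hypothesis MC : forall i j, M i *m M j = M j *m M i.

Lemma stable_eigenvalue (U A : 'M[C]_n) : U != 0 -> (U *m A <= U)%MS ->
  exists c, (U :&: eigenspace A c)%MS != 0.
Proof.
move=> U0 UA.
have B0 : (0 < \rank U)%N by rewrite lt0n mxrank_eq0.
have : (row_base U *m A <= row_base U)%MS.
  by rewrite (eqmxMr _ (eq_row_base U)) eq_row_base.
case/submxP => D eD.
have [c] : exists c, root (char_poly D) c.
  by apply/closed_rootP; rewrite size_char_poly eqSS -lt0n.
rewrite -eigenvalue_root_char => /eigenvalueP[y yD y0].
exists c; apply/rowV0Pn; exists (y *m row_base U).
  rewrite sub_capmx (submx_trans (submxMl _ _)) ?eq_row_base //=.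
  by apply/eigenspaceP; rewrite -mulmxA eD mulmxA yD scalemxAl.
apply: contraNneq y0 => e; apply/eqP/(row_free_inj (row_base_free U)).
by rewrite e mul0mx.
Qed.

(** Induction on rank: if some [M i] is not scalar on U, one of its eigenspaces cuts U properly and
    remains stable by commutation. *)
Lemma common_row_eigenvector (U : 'M[C]_n) : U != 0 ->
  (forall i, (U *m M i <= U)%MS) ->
  exists v : 'rV[C]_n, [/\ v != 0, (v <= U)%MS & forall i, exists c, v *m M i = c *: v].
Proof.
elim: {U}_.+1 {-2}U (ltnSn (\rank U)) => // d IH U rU U0 US.
have [sc|] := pselect (forall i, exists c, U *m M i = c *: U).
  have /rowV0Pn[v vU v0] := U0; exists v; split=> // i.
  by have [c e] := sc i; have /submxP[y ->] := vU; exists c; rewrite -mulmxA e -scalemxAr.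
move=> /existsNP[i ni].
have [c U'0] := stable_eigenvalue U0 (US i).
set U' := (_ :&: _)%MS in U'0.
have [|||v [v0 vU' Hv]] := IH U'.
- rewrite ltnS in rU; apply: leq_trans rU; rewrite ltn_neqAle mxrankS ?capmxSl // andbT.
  apply/eqP => e; apply: ni; exists c; apply/eigenspaceP.
  suff : (U <= U')%MS by move/submx_trans; apply; exact: capmxSr.
  by rewrite -(mxrank_leqif_sup (capmxSl _ _)).2 e.
- by [].
- move=> j; rewrite sub_capmx (submx_trans (submxMr _ (capmxSl _ _)) (US j)) /=.
  apply/eigenspaceP; rewrite -mulmxA -MC mulmxA scalemxAl.
  by congr (_ *m _); apply/eigenspaceP; exact: capmxSr.
by exists v; split=> //; apply: submx_trans vU' (capmxSl _ _).
Qed.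

End CommonEigenvector.

Section Embeddings.
Variables (k : fieldExtType rat) (C : numClosedFieldType) (w : k).

(* A root of the minimal polynomial of w is an eigenvalue of multiplication by
   w; the eigenvalues of a common eigenvector of all multiplications form an
   embedding. *)
Lemma minimal_polynomial : exists m : {poly rat},
  [/\ m \is monic, (map_poly (in_alg k) m).[w] = 0,
      (forall p, (map_poly (in_alg k) p).[w] = 0 -> m %| p) &
      forall r : C, root (map_poly ratr m) r -> exists tau : {rmorphism k -> C}, tau w = r].
Proof.
have [n [M [MB MM MZ M1 M0]]] := regular_representation k.
have M00 : M 0 = 0 by rewrite -(subrr 0) MB subrr.
have MN y : M (- y) = - M y by rewrite -sub0r MB M00 sub0r.
have MD x y : M (x + y) = M x + M y.
  by rewrite -[y in LHS]opprK MB MN opprK.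
have Mp p : horner_mx (M w) p = M (map_poly (in_alg k) p).[w].
  elim/poly_ind: p => [|p c IH]; first by rewrite !rmorph0 horner0 M00.
  rewrite !rmorphD !rmorphM /= horner_mx_X horner_mx_C IH map_polyX map_polyC.
  by rewrite hornerMXaddC MD MM MZ M1 scalemx1.
exists (mxminpoly (M w)); split.
- exact: mxminpoly_monic.
- by apply: M0; rewrite -Mp mx_root_minpoly.
- by move=> p p0; apply: mxminpoly_min; rewrite Mp p0.
move=> r; rewrite -mxminpoly_map -eigenvalue_root_min => ev.
pose N x := map_mx (ratr : rat -> C) (M x).
have NC x y : N x *m N y = N y *m N x by rewrite /N -!map_mxM -!MM mulrC.
have [||v [v0 vU /choice[f Hf]]] := @common_row_eigenvector C k _ N NC (eigenspace (N w) r).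
- exact: ev.
- move=> x; apply/eigenspaceP; rewrite -mulmxA -NC mulmxA scalemxAl.
  by congr (_ *m _); apply/eigenspaceP.
have inj c d : c *: v = d *: v -> c = d.
  by move/eqP; rewrite -subr_eq0 -scalerBl scaler_eq0 (negPf v0) orbF subr_eq0 => /eqP.
have [|||tau Htau] := @rmorphism_of _ _ f.
- by move=> x y; apply: inj; rewrite -Hf /N MB map_mxB mulmxBr -!/(N _) !Hf scalerBl.
- move=> x y; apply: inj; rewrite -Hf /N MM map_mxM mulmxA -!/(N _) Hf -scalemxAl Hf.
  by rewrite scalerA.
- by apply: inj; rewrite -Hf /N M1 map_mx1 mulmx1 scale1r.
exists tau; rewrite Htau; apply: inj; rewrite -Hf.
by apply/eigenspaceP.
Qed.

End Embeddings.

(** * Finiteness of traces *)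

(** Gauss's lemma: the leading coefficients of the two integral factors multiply to 1, so only a
    sign has to be corrected. *)
Lemma monic_factor_int (m : {poly rat}) (q : {poly int}) :
  m \is monic -> q \is monic -> m %| map_poly intr q ->
  exists2 mz : {poly int}, mz \is monic & m = map_poly intr mz.
Proof.
move=> mm mq /dvdpP_rat_int[p1 [a a0 em] [r eq]].
pose l := lead_coef p1.
have ll : l * lead_coef r = 1 by rewrite /l -lead_coefM -eq; apply/eqP.
have l2 : l * l = 1.
  have : (`|l|%N * `|lead_coef r|%N)%N = 1%N by rewrite -abszM ll.
  by move/eqP; rewrite muln_eq1 => /andP[/eqP + _]; lia.
have al : a * l%:~R = 1.
  have /monicP := mm; rewrite em lead_coefZ lead_coef_map_inj ?rmorph0.
  - by rewrite /l.
  - exact: intr_inj.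
  - by [].
have ea : a = l%:~R.
  have l2q : l%:~R * l%:~R = 1 :> rat by rewrite -intrM l2.
  transitivity (a * (l%:~R * l%:~R)); first by rewrite l2q mulr1.
  by rewrite mulrA al mul1r.
exists (l *: p1); first by rewrite monicE lead_coefZ l2.
by rewrite em ea map_polyZ.
Qed.

Section MinimalPolynomial.
Variables (k : fieldExtType rat) (C : numClosedFieldType) (w : k) (m : {poly rat}).
Hypotheses (mm : m \is monic) (m0 : (map_poly (in_alg k) m).[w] = 0).
Hypothesis mmin : forall p, (map_poly (in_alg k) p).[w] = 0 -> m %| p.

(** Of the gcd and its cofactor in m, one vanishes at w, and minimality applies to it. *)
Lemma minpoly_coprime p : coprimep m p \/ m %| p.
Proof.
have /dvdpP[e em] := dvdp_gcdl m p.
have : (map_poly (in_alg k) (e * gcdp m p)).[w] = 0 by rewrite -em.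
rewrite rmorphM hornerM /= => /eqP; rewrite mulf_eq0 => /orP[]/eqP.
  move=> /mmin me; left; rewrite /coprimep.
  have e0 : e != 0.
    by apply: contraTneq mm => e0; rewrite em e0 mul0r monicE lead_coef0 eq_sym oner_eq0.
  have g0 : gcdp m p != 0 by rewrite gcdp_eq0 negb_and monic_neq0.
  have sz : size m = (size e + size (gcdp m p)).-1 by rewrite {1}em size_mul.
  have := dvdp_leq e0 me; move: e0 g0; rewrite -!size_poly_gt0 sz; move: (size e) (size (gcdp m p)) => x y; lia.
by move=> /mmin mg; right; apply: dvdp_trans mg (dvdp_gcdr _ _).
Qed.

Lemma minpoly_roots : exists2 rs : seq C, uniq rs &
  map_poly ratr m = \prod_(r <- rs) ('X - r%:P).
Proof.
have [rs e] := closed_field_poly_normal (map_poly (ratr : rat -> C) m).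
move: e; rewrite (monicP _) ?map_monic // scale1r => e; exists rs => //.
rewrite -separable_prod_XsubC -e separable_poly.unlock deriv_map coprimep_map.
have sm : (1 < size m)%N.
  rewrite ltnNge; apply/negP => sm; move: mm m0.
  rewrite (size1_polyC sm) => /monicP; rewrite lead_coefC => ->.
  by rewrite map_polyC /= hornerC scale1r => /eqP; rewrite oner_eq0.
have [//|/dvdp_leq] := minpoly_coprime m^`().
have d0 : m^`() != 0.
  apply/eqP => /polyP/(_ (size m).-2); rewrite coef_deriv coef0 prednK -?subn1 ?subn_gt0 //.
  by rewrite subn1 -/(lead_coef m) (monicP mm) => /eqP; rewrite pnatr_eq0; lia.
by move=> /(_ d0); rewrite leqNgt lt_size_deriv ?monic_neq0.
Qed.

End MinimalPolynomial.

(** * Bounds on degrees and coefficients *)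

Section Bounds.
Variable R : realType.
Local Notation C := R[i].
Local Notation normc := (@ComplexField.Normc.normc R).

Lemma normc_ge0 (x : C) : 0 <= normc x.
Proof. by case: x => a b; exact: sqrtr_ge0. Qed.

Lemma normc_real (x : R) : normc x%:C%C = `|x|.
Proof. by rewrite /= expr0n addr0 sqrtr_sqr. Qed.

Lemma normcB_sym (x y : C) : normc (x - y) = normc (y - x).
Proof.
by rewrite -(opprB y x); case: (y - x) => a b /=; rewrite !sqrrN.
Qed.

Lemma normc_prod (I : Type) (s : seq I) (F : I -> C) :
  normc (\prod_(i <- s) F i) = \prod_(i <- s) normc (F i).
Proof.
by apply: (big_morph normc (@ComplexField.Normc.normcM R) (@ComplexField.Normc.normc1 R)).
Qed.

Lemma normc_int_ge1 (z : int) : z != 0 -> 1 <= normc z%:~R.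
Proof.
move=> z0; have -> : z%:~R = (z%:~R : R)%:C%C by rewrite rmorph_int.
by rewrite normc_real -intr_norm ler1z; move: z0; lia.
Qed.

(* With [y = x^2 - x] this is [y (y - 1) (y - 2)]: an integer polynomial that
   is smaller than 1 on the interval [[-1, 2]]. *)
Definition small_poly (A : pzRingType) (x : A) : A :=
  x * (x - 1) * (x + 1) * (x - 2) * (x * x - x - 1).

Lemma small_poly_real (x : R) : -1 <= x <= 2 -> normc (small_poly x%:C%C) <= 3 / 4.
Proof.
move=> /andP[x1 x2].
have -> : small_poly x%:C%C = (small_poly x)%:C%C.
  by rewrite /small_poly !(rmorphM, rmorphB, rmorphD) /= !rmorph1 ?rmorph_nat.
rewrite normc_real; pose s := x * x - x - 1.
have -> : small_poly x = s ^+ 3 - s by rewrite /small_poly /s; ring.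
have s1 : s <= 1 by rewrite /s; nra.
have s2 : - 5 / 4 <= s.
  have := sqr_ge0 (x - 1 / 2).
  have -> : (x - 1 / 2) ^+ 2 = s + 5 / 4 by rewrite /s; field.
  by lra.
(* The first cubic vanishes at the endpoint s = -5/4, where s^3 - s = -45/64. *)
rewrite ler_norml; apply/andP; split.
  have : 0 <= (s + 5 / 4) * ((s - 5 / 8) ^+ 2 + 11 / 64).
    by apply: mulr_ge0; [lra|have := sqr_ge0 (s - 5 / 8); lra].
  have -> : (s + 5 / 4) * ((s - 5 / 8) ^+ 2 + 11 / 64) = s ^+ 3 - s + 45 / 64 by field.
  by lra.
(* For s <= 1 the cube lies below its tangent at -1/2, so s^3 - s <= (1 - s) / 4 <= 9/16. *)
have : 0 <= (1 - s) * (s + 1 / 2) ^+ 2.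
  by apply: mulr_ge0; [lra|exact: sqr_ge0].
have -> : (1 - s) * (s + 1 / 2) ^+ 2 = - s ^+ 3 + s * (3 / 4) + 1 / 4 by field.
by lra.
Qed.

(** One constant for each factor; 31 is 25 + 5 + 1. *)
Lemma small_poly_disk (x : C) : normc x <= 5 -> normc (small_poly x) <= 5 * 6 * 6 * 7 * 31.
Proof.
move=> x5.
have n1 : normc 1 = 1 := @ComplexField.Normc.normc1 R.
have nm1 : normc (- 1) = 1 by rewrite -sub0r normcB_sym subr0.
have n2 : normc (- 2) = 2.
  have e2 : 2 = (2 : R)%:C%C :> C by rewrite rmorph_nat.
  by rewrite -sub0r normcB_sym subr0 e2 normc_real ger0_norm.
have xx : normc (x * x) <= 25.
  rewrite ComplexField.Normc.normcM; have := normc_ge0 x; nra.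
have h1 := le_normcD x (- 1); have h2 := le_normcD x 1; have h3 := le_normcD x (- 2).
have h4 := le_normcD (x * x - x) (- 1); have h5 := le_normcD (x * x) (- x).
have nx : normc (- x) = normc x by rewrite -sub0r normcB_sym subr0.
rewrite /small_poly !ComplexField.Normc.normcM.
by do ?[apply: ler_pM; rewrite ?mulr_ge0 ?normc_ge0 //]; lra.
Qed.

(** g and h are the roots of the quadratic factor of [small_poly]; p(g) reduces to a g + b, whose
    norm is b^2 + ab - a^2. *)
Lemma golden_product (p : {poly int}) (g h : C) : g * g = g + 1 -> h = 1 - g ->
  exists z : int, (map_poly intr p).[g] * (map_poly intr p).[h] = z%:~R.
Proof.
move=> gg eh.
have [a [b [-> ->]]] : exists a b : int, (map_poly intr p).[g] = a%:~R * g + b%:~R /\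
    (map_poly intr p).[h] = a%:~R * h + b%:~R.
  elim/poly_ind: p => [|p c [a [b [e1 e2]]]].
    by exists 0, 0; rewrite rmorph0 !horner0 !mul0r addr0.
  exists (a + b), (a + c).
  rewrite !rmorphD !rmorphM /= !map_polyX !map_polyC !hornerMXaddC /= e1 e2 ?intrD eh.
  split.
    transitivity (a%:~R * (g * g) + b%:~R * g + c%:~R); first by ring.
    by rewrite gg; ring.
  transitivity (a%:~R * (1 - 2 * g + g * g) + b%:~R * (1 - g) + c%:~R); first by ring.
  by rewrite gg; ring.
exists (b * b + a * b - a * a).
rewrite !(rmorphD, rmorphB, rmorphM) /= eh.
transitivity (- a%:~R * a%:~R * (g * g - g) + a%:~R * b%:~R + b%:~R * b%:~R); first by ring.
by rewrite gg; ring.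
Qed.

(** Up to sign this is a resultant: regrouped by the roots 0, 1, -1, 2, g, h of [small_poly], the
    product becomes a product of integers, nonzero by assumption. *)
Lemma small_poly_norm (mz : {poly int}) (rs : seq C) :
  map_poly intr mz = \prod_(r <- rs) ('X - r%:P) ->
  (forall r, r \in rs -> small_poly r != 0) ->
  1 <= \prod_(r <- rs) normc (small_poly r).
Proof.
move=> e nz; pose ev x := \prod_(r <- rs) normc (r - x).
have evE x : ev x = normc (map_poly intr mz).[x].
  rewrite e horner_prod normc_prod; apply: eq_bigr => r _.
  by rewrite hornerXsubC normcB_sym.
pose g : C := (1 + sqrtC 5) / 2; pose h := 1 - g.
have gg : g * g = g + 1.
  rewrite /g; transitivity ((1 + 2 * sqrtC 5 + sqrtC 5 ^+ 2) / 4 : C); first by field.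
  by rewrite sqrtCK; field.
have [z zE] := golden_product mz gg (erefl h).
have eint (j : int) : (map_poly intr mz).[j%:~R] = (mz.[j])%:~R :> C.
  by rewrite horner_map.
pose N := mz.[0] * mz.[1] * mz.[-1] * mz.[2] * z.
have PE : \prod_(r <- rs) normc (small_poly r) = normc N%:~R.
  transitivity (ev (0%:~R) * ev (1%:~R) * ev ((-1)%:~R) * ev (2%:~R) * (ev g * ev h)).
    rewrite /ev -!big_split /=; apply: eq_bigr => r _.
    rewrite -!ComplexField.Normc.normcM; congr normc; rewrite /small_poly /h.
    transitivity (r * (r - 1) * (r + 1) * (r - 2) * (r * r - r + g - g * g)).
      by rewrite gg; ring.
    by ring.
  rewrite !evE !eint /N !(intrM) !ComplexField.Normc.normcM; congr (_ * _).
  by rewrite -ComplexField.Normc.normcM zE.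
rewrite PE; apply: normc_int_ge1; apply/eqP => N0.
move: PE; rewrite N0 ComplexField.Normc.normc0 => /eqP; rewrite prodf_seq_eq0.
move=> /hasP[r rrs /= /eqP/ComplexField.Normc.eq0_normc]; apply/eqP.
exact: nz.
Qed.

(** The roots being distinct, at most two of them contribute the disk constant; the others
    contribute at most 3/4 each. *)
Lemma degree_bound (t : C) (rs : seq C) : normc t <= 5 -> uniq rs ->
  1 <= \prod_(r <- rs) normc (small_poly r) ->
  (forall r, r \in rs -> [\/ r = t, r = conjc t |
     exists2 u : R, -1 <= u <= 2 & r = u%:C%C]) ->
  1 <= (5 * 6 * 6 * 7 * 31) ^+ 2 * (3 / 4 : R) ^+ (size rs - 2).
Proof.
move=> t5 urs P1 H; apply: le_trans P1 _.
pose Q r := (r == t) || (r == conjc t).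
have cn : (count Q rs <= 2)%N.
  have : (size (seq.filter Q rs) <= size [:: t; conjc t])%N.
    apply: uniq_leq_size; first exact: filter_uniq.
    by move=> r; rewrite mem_filter !inE => /andP[].
  by rewrite size_filter.
have bd s : {subset s <= rs} -> \prod_(r <- s) normc (small_poly r) <=
    (5 * 6 * 6 * 7 * 31) ^+ count Q s * (3 / 4) ^+ (size s - count Q s).
  elim: s => [|r s IH] sub; first by rewrite big_nil mulr1.
  rewrite big_cons /=; have {}IH := IH (fun x xs => sub x (@mem_behead _ (r :: s) x xs)).
  have cs : (count Q s <= size s)%N := count_size Q s.
  have p0 : 0 <= \prod_(r <- s) normc (small_poly r).
    by apply: prodr_ge0 => x _; exact: normc_ge0.
  have [Qr|nQr] := boolP (Q r).
    rewrite add1n subSS exprS -mulrA; apply: ler_pM => //; first exact: normc_ge0.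
    apply: small_poly_disk; case/orP: Qr => /eqP-> //.
    by case: (t) t5 => a b /=; rewrite sqrrN.
  rewrite add0n subSn // exprS mulrCA; apply: ler_pM => //; first exact: normc_ge0.
  have [e|e|[u u12 ->]] := H r (sub r (mem_head _ _)).
  - by rewrite /Q e eqxx in nQr.
  - by rewrite /Q e eqxx orbT in nQr.
  - exact: small_poly_real.
apply: le_trans (bd rs (fun x xs => xs)) _.
apply: ler_pM; rewrite ?exprn_ge0 //; try lra.
  by apply: ler_weXn2l => //; lra.
by apply: ler_wiXn2l; [lra|lra|apply: leq_sub2l].
Qed.

(** Bernoulli's inequality (4/3)^j >= 1 + j/3 turns the hypothesis into 1 + j/3 <= K. *)
Lemma geometric_bound (K : R) : exists N : nat, forall n,
  1 <= K * (3 / 4 : R) ^+ (n - 2) -> (n <= N)%N.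
Proof.
have bern (n : nat) : (1 + n%:R / 3) * (3 / 4 : R) ^+ n <= 1.
  elim: n => [|n IH]; first by rewrite mul0r addr0 mulr1.
  apply: le_trans IH; rewrite exprS mulrA; apply: ler_wpM2r; first by rewrite exprn_ge0 //; lra.
  by rewrite -natr1; have : 0 <= n%:R :> R by []; lra.
exists (Num.bound (`|K| * 3) + 2)%N => n; set j := (n - 2)%N => h.
have b := bern j; set c := (3 / 4) ^+ j in h b.
have j0 : 0 <= j%:R :> R by [].
have c0 : 0 < c by rewrite exprn_gt0 //; lra.
have jK : j%:R <= `|K| * 3.
  have : (1 + j%:R / 3) * c <= K * c by apply: le_trans b h.
  by rewrite ler_pM2r //; have := ler_norm K; lra.
have := le_lt_trans jK (archi_boundP (mulr_ge0 (normr_ge0 K) (ler0n R 3))).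
by rewrite ltr_nat /j; move: (Num.bound _) => X; lia.
Qed.

(** Each factor X - r multiplies the bound by 1 + 5. *)
Lemma coef_bound (rs : seq C) i : (forall r, r \in rs -> normc r <= 5) ->
  normc (\prod_(r <- rs) ('X - r%:P))`_i <= 6 ^+ size rs.
Proof.
elim: rs i => [|r rs IH] i H.
  rewrite big_nil coef1 expr0; case: (i == 0)%N.
    by rewrite mulr1n ComplexField.Normc.normc1.
  by rewrite mulr0n ComplexField.Normc.normc0.
have {}IH j := IH j (fun x xs => H x (@mem_behead _ (r :: rs) x xs)).
rewrite big_cons mulrBl coefB coefXM coefCM /= exprS.
set q := \prod_(_ <- _) _ in IH *.
have r5 := H r (mem_head _ _).
have h (x : C) : normc (- x) = normc x by rewrite -sub0r normcB_sym subr0.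
apply: le_trans (le_normcD _ _) _; rewrite h ComplexField.Normc.normcM.
have -> : 6 * 6 ^+ size rs = 6 ^+ size rs + 5 * 6 ^+ size rs :> R by ring.
apply: lerD; last by apply: ler_pM; rewrite ?normc_ge0.
case: (i == 0)%N => //; first by rewrite ComplexField.Normc.normc0 exprn_ge0.
Qed.

Lemma finite_roots (p : {poly C}) : p != 0 -> finite_set [set x | root p x].
Proof.
move=> p0; have [rs e] := closed_field_poly_normal p.
apply: (@sub_finite_set _ _ [set` rs]); last exact: finite_seq.
by move=> x /=; rewrite e rootZ ?lead_coef_eq0 // root_prod_XsubC.
Qed.

(** Shifting coefficients by B maps [-B, B] into ['I_(2 * B).+1], so the polynomials come from a
    finite type. *)
Lemma finite_bounded_degree (N B : nat) :
  finite_set [set t : C | exists p : {poly int},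
    [/\ p \is monic, (size p <= N)%N, (forall i, (absz (p`_i)%R <= B)%N) &
        root (map_poly intr p) t]].
Proof.
pose T := {ffun 'I_N -> 'I_(2 * B).+1}.
pose P (f : T) : {poly C} := map_poly intr (\poly_(i < N)
  (if insub i is Some j then (f j)%:Z - B%:Z else 0)).
apply: (@sub_finite_set _ _ (\bigcup_(f in [set f : T | P f != 0]) [set x | root (P f) x])).
  move=> t [p [mp sp bp rt]].
  pose f : T := [ffun j : 'I_N => inord (absz (p`_j + B%:Z))].
  have eP : P f = map_poly intr p.
    congr map_poly; apply/polyP => i; rewrite coef_poly.
    case: ltnP => [iN|Ni]; last by rewrite nth_default // (leq_trans sp).
    rewrite insubT ffunE inordK; last by have := bp i; rewrite /=; lia.
    by rewrite /= gez0_abs ?addrK //; have := bp i; move: (p`_i)%R => c; lia.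
  exists f; rewrite /= eP //.
  by rewrite map_poly_eq0_id0 ?monic_neq0 // (monicP mp) oner_eq0.
apply: bigcup_finite; first exact: finite_finset.
by move=> f /= Pf; apply: finite_roots.
Qed.

End Bounds.

Section Finiteness.
Variable R : realType.
Local Notation C := R[i].
Local Notation normc := (@ComplexField.Normc.normc R).

Lemma real_embedding (k : fieldExtType rat) (tau : {rmorphism k -> C}) :
  (forall x, complex.Im (tau x) = 0) ->
  exists phi : {rmorphism k -> R}, forall x, tau x = (phi x)%:C%C.
Proof.
move=> tr; pose f x := complex.Re (tau x).
have ef x : tau x = (f x)%:C%C.
  by apply/eqP; rewrite eq_complex /= eqxx tr eqxx.
have inj : injective (fun x : R => x%:C%C) by move=> x y [].
have [|||phi Hphi] := @rmorphism_of _ _ f.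
- by move=> x y; apply: inj; rewrite rmorphB /= -!ef rmorphB.
- by move=> x y; apply: inj; rewrite rmorphM /= -!ef rmorphM.
- by apply: inj; rewrite rmorph1 -ef rmorph1.
by exists phi => x; rewrite ef Hphi.
Qed.

Lemma finite_traces : finite_set [set t : C |
  exists (k : fieldExtType rat) (iota : {rmorphism k -> C}) (w : k),
    [/\ one_complex_place iota, iota w = t, integralOver (intr : int -> C) t,
        forall phi : {rmorphism k -> R}, -1 <= phi w <= 2 & normc t <= 5]].
Proof.
have [N HN] := @geometric_bound R ((5 * 6 * 6 * 7 * 31) ^+ 2).
pose B := (6 ^ N)%N.
pose P6 : {poly C} := 'X * ('X - 1) * ('X + 1) * ('X - 1 - 1) * ('X * 'X - 'X - 1).
have P6E x : P6.[x] = small_poly x.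
  rewrite /P6 /small_poly !(hornerM, hornerD, hornerN, hornerX, hornerC).
  by rewrite -!addrA -!opprD.
apply: (@sub_finite_set _ _ ([set t | exists p : {poly int},
    [/\ p \is monic, (size p <= N.+1)%N, (forall i, (absz (p`_i)%R <= B)%N) &
        root (map_poly intr p) t]] `|` [set x | root P6 x])); last first.
  rewrite finite_setU; split; first exact: finite_bounded_degree.
  (* The value at 3 is 3 * 2 * 4 * 1 * 5 = 120. *)
  apply: finite_roots; apply/eqP => P60; have := P6E 3; rewrite P60 horner0.
  rewrite /small_poly => /esym/eqP; rewrite (_ : _ * _ = 120%:R); last by ring.
  by rewrite pnatr_eq0.
move=> t [k [iota [w [one ew [q mq rq] wR t5]]]].
(* Roots of [small_poly] are set aside, as their norm is zero and bounds nothing. *)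
have [Pt|nPt] := eqVneq (small_poly t) 0; [right|left].
  by rewrite /= /root P6E Pt.
have [m [mm m0 mmin emb]] := minimal_polynomial C w.
have iQ (p : {poly rat}) : iota (map_poly (in_alg k) p).[w] = (map_poly ratr p).[t].
  rewrite -horner_map -map_poly_comp ew; congr (_.[_]).
  by apply: eq_map_poly => x /=; rewrite -[RHS](fmorph_eq_rat (iota \o in_alg k)).
have iZ (p : {poly int}) : map_poly (ratr : rat -> C) (map_poly intr p) = map_poly intr p.
  by rewrite -map_poly_comp; apply: eq_map_poly => x /=; rewrite ratr_int.
have [|mz mmz emz] := @monic_factor_int m q mm mq.
  apply: mmin; apply: (fmorph_inj iota); rewrite iQ rmorph0 iZ.
  exact/eqP.
have [rs urs ers] := minpoly_roots C mm m0 mmin.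
have rt : root (map_poly ratr m) t.
  by apply/eqP; rewrite -iQ m0 rmorph0.
have Hr r : r \in rs -> [\/ r = t, r = conjc t |
     exists2 u : R, -1 <= u <= 2 & r = u%:C%C].
  move=> rrs; have [tau etau] : exists tau : {rmorphism k -> C}, tau w = r.
    by apply: emb; rewrite ers root_prod_XsubC.
  have [re|nre] := pselect (exists x, complex.Im (tau x) != 0).
    have [e|e] := one.2 tau re; [apply: Or31|apply: Or32]; by rewrite -etau e ew.
  have [|phi Hphi] := @real_embedding k tau.
    by move=> x; apply/eqP; apply: contrapT => /negP nx; apply: nre; exists x.
  by apply: Or33; exists (phi w); [exact: wR|rewrite -etau Hphi].
pose p6 : {poly rat} := 'X * ('X - 1) * ('X + 1) * ('X - 1 - 1) * ('X * 'X - 'X - 1).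
have ep6 : map_poly (ratr : rat -> C) p6 = P6.
  rewrite /p6 /P6 !(rmorphM, rmorphB, rmorphD) /= !map_polyX !rmorph1.
  by [].
(* By irreducibility of m, a common root with [p6] would make [p6] vanish at t too. *)
have nz r : r \in rs -> small_poly r != 0.
  move=> rrs; rewrite -P6E -ep6.
  have [cp|/dvdpP[e ee]] := minpoly_coprime mm m0 mmin p6.
    apply: (@coprimep_root _ (map_poly ratr m)); first by rewrite coprimep_map.
    by rewrite ers root_prod_XsubC.
  case/eqP: nPt; rewrite -P6E -ep6 ee rmorphM hornerM /= (eqP rt) mulr0 //.
have ezs : map_poly intr mz = \prod_(r <- rs) ('X - r%:P) :> {poly C}.
  by rewrite -ers emz iZ.
have db := degree_bound t5 urs (small_poly_norm ezs nz) Hr.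
have sN := HN _ db.
have r5 r : r \in rs -> normc r <= 5.
  move=> /Hr[->//|->|[u u12 ->]]; first by case: (t) t5 => a b /=; rewrite sqrrN.
  rewrite normc_real ler_norml; move: u12; lra.
exists mz; split=> //.
- have := congr1 (fun p : {poly C} => size p) ezs; rewrite size_prod_XsubC.
  by rewrite size_map_inj_poly ?rmorph0 // => [->//|]; exact: intr_inj.
- move=> i; have := coef_bound i r5; rewrite -ezs coef_map /=.
  have -> : (mz`_i)%:~R = ((mz`_i)%:~R : R)%:C%C by rewrite rmorph_int.
  rewrite normc_real -intr_norm => h.
  have : (`|mz`_i|%:~R : R) <= B%:R.
    apply: le_trans h _; rewrite /B natrX; apply: ler_weXn2l => //; lra.
  by rewrite -[B%:R]/(B%:Z%:~R) ler_int; move: (mz`_i)%R (B) => c b; lia.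
- by rewrite -iZ -emz.
Qed.

End Finiteness.

(** * Regular triangle groups *)

Section Assembly.
Variable R : realType.
Local Notation C := R[i].
Local Notation normc := (@ComplexField.Normc.normc R).
Variables (D : set (PSL2 R)) (A B M : SL2 R) (t : C).
Hypotheses (eD : D = generated [set toPSL2 A; toPSL2 B; toPSL2 M])
  (tr0 : [/\ \tr (val A) = 0, \tr (val B) = 0 & \tr (val M) = 0])
  (trt : [/\ \tr (val A *m val B) = - t, \tr (val A *m val M) = - t &
     \tr (val M *m val B) = - t])
  (nD : ~ virtually_abelian D).

Lemma no_fixed_line v : v != 0 -> ~ D `<=` line_stabilizer v.
Proof.
move=> v0 Dv; case: tr0 => tA tB tM; apply: nD; rewrite eD.
apply: (half_turns_fixing_line v0) => x Sx.
have /Dv : D x by rewrite eD; apply: sub_generated.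
by case: Sx => [[->|->]|->] /line_stabilizerE; [exists A|exists B|exists M].
Qed.

Lemma regular_triple_trace_neq2 : t != 2.
Proof.
apply/eqP => t2; move: trt; rewrite t2 => trt2.
have [|v v0 [vA vB vM]] := regular_triple_eigenvector tr0 _ trt2.
  by split; exact: SL2_det.
apply: (no_fixed_line v0); rewrite eD; apply: generated_sub.
  exact: line_stabilizer_subgroup.
by move=> x [[->|->]|->]; apply/line_stabilizerE.
Qed.

Lemma nearly_arithmetic_trace : nearly_arithmetic D ->
  exists (k : fieldExtType rat) (iota : {rmorphism k -> C}) (w : k),
    [/\ one_complex_place iota, iota w = t, integralOver (intr : int -> C) t,
        forall phi : {rmorphism k -> R}, -1 <= phi w <= 2 & normc t <= 5].
Proof.
case=> sD [E [arithE _ DE]] nfree; case: arithE => sE [k [iota [a [b [Phi [Od H]]]]]].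
case: H => one [a0 b0] ram PhiB [ordO EO].
have DG G : G \in [:: A; B; M] -> D (toPSL2 G).
  rewrite !inE eD => G3; apply: sub_generated.
  by case/or3P: G3 => /eqP ->; [left; left|left; right|right].
have [|w ew wR] := regular_triple_trace_field a0 b0 ram (Phi := Phi) _ tr0 trt.
  move=> G /DG; apply: (arithmetic_lift a0 b0 PhiB sD sE DE EO nD).
  exact: no_fixed_line.
exists k, iota, w; split=> //.
  have -> : t = - \tr (val (A * B)%g) by case: trt => e _ _; rewrite SL2_valM e opprK.
  apply: integral_opp; apply: (@arithmetic_trace_integral _ _ _ _ _ Phi Od ordO D E (A * B)%g sE EO).
  have [_ DM _] := sD; rewrite -toPSL2_mul; apply: DE.
  by apply: DM; apply: DG; rewrite !inE eqxx ?orbT.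
rewrite leNgt; apply/negP => t5; apply: nfree; rewrite eD.
exact: (regular_triple_large (ltW t5) tr0 trt).
Qed.

End Assembly.

Theorem theorem5p2 (R : realType) :
  finite_set (@conjugacy_class (PSL2 R) @`
    [set D : set (PSL2 R) |
       [/\ kleinian D, nearly_arithmetic D & regular_triangle_group D]]).
Proof.
pose T := [set t : R[i] | t != 2] `&` [set t : R[i] |
  exists (k : fieldExtType rat) (iota : {rmorphism k -> R[i]}) (w : k),
    [/\ one_complex_place iota, iota w = t, integralOver (intr : int -> R[i]) t,
        forall phi : {rmorphism k -> R}, -1 <= phi w <= 2 &
        ComplexField.Normc.normc t <= 5]].
pose F (t : R[i]) := [set conjugacy_class D | D in [set D : set (PSL2 R) |
    exists A B M : SL2 R,
      [/\ D = generated [set toPSL2 A; toPSL2 B; toPSL2 M],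
        [/\ \tr (val A) = 0, \tr (val B) = 0 & \tr (val M) = 0] &
        [/\ \tr (val A *m val B) = - t, \tr (val A *m val M) = - t &
            \tr (val M *m val B) = - t]]]].
apply: (@sub_finite_set _ _ (\bigcup_(t in T) F t)); last first.
  apply: bigcup_finite; first by apply: finite_setIr; exact: finite_traces.
  by move=> t [t2 _]; exact: finite_conjugacy_classes.
move=> _ [D [[sD _ nD] nearD /regular_triangle_group_lifts[A [B [M [t [eD tr0 trt]]]]]] <-].
exists t; last by exists D => //; exists A, B, M.
split; first exact: (regular_triple_trace_neq2 eD tr0 trt nD).
exact: (nearly_arithmetic_trace eD tr0 trt nD nearD).
Qed.
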